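(* Let $1\le d_1<\dots<d_s\le n-1$, and let $V=\mathbb C^n$ have basis $v_1,\dots,v_n$. For $1\le i<j\le n$ define $pr_{i+1,j}:V\to V$ by $$pr_{i+1,j}\Big(\sum_{l=1}^nc_lv_l\Big)=\sum_{l=1}^ic_lv_l+\sum_{l=j+1}^nc_lv_l.$$ The image of the embedding of the degenerate flag variety $\mathcal F^a(d_1,\dots,d_s)$ in $Gr(d_1,n)\times\dots\times Gr(d_s,n)$ consists of all sequences $(V_1,\dots,V_s)$, $V_l\in Gr(d_l,n)$, such that for all $1\le l<m\le s$ $$pr_{d_l+1,d_m}V_l\subset V_m.$$
   Context: Everything is over $\mathbb{C}$. $Gr(d,n)$ is the Grassmannian of $d$-dimensional subspaces of $V=\mathbb{C}^n$. Let $\mathfrak{g}=\mathfrak{sl}_n=\mathfrak{n}\oplus\mathfrak{h}\oplus\mathfrak{n}^-$ be the standard Cartan decomposition (strictly upper triangular, diagonal, strictly lower triangular), $\mathfrak b=\mathfrak n\oplus\mathfrak h$, $B\subset SL_n$ the Borel subgroup with Lie algebra $\mathfrak b$, $M=\dim\mathfrak{n}$. The degenerate algebra is $\mathfrak g^a=\mathfrak b\oplus(\mathfrak n^-)^a$, where $(\mathfrak n^-)^a$ is an abelian ideal equal to $\mathfrak n^-$ as a vector space, and $\mathfrak b$ acts on it via the identification $(\mathfrak n^-)^a\simeq\mathfrak g/\mathfrak b$. The corresponding group is $G^a=B\ltimes\mathbb G_a^M$, with $\mathbb G_a$ the additive group of the field and $\mathbb G_a^M$ the group of $(\mathfrak n^-)^a$.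 For a dominant integral weight $\lambda$ let $V_\lambda$ be the irreducible $\mathfrak g$-module with highest weight vector $v_\lambda$, and $F_s=\mathrm{span}\{x_1\cdots x_l v_\lambda: x_i\in\mathfrak g,\ l\le s\}$ the PBW filtration. The associated graded space $V_\lambda^a=\bigoplus_{s\ge0}F_s/F_{s-1}$ ($F_{-1}=0$) is naturally a $\mathfrak g^a$-module and a $G^a$-module: $x\in(\mathfrak n^-)^a$ acts by the induced maps $F_s/F_{s-1}\to F_{s+1}/F_s$ and $\mathfrak b$ by the induced maps $F_s/F_{s-1}\to F_s/F_{s-1}$. The degenerate flag variety is the closure $\mathcal F^a_\lambda=\overline{\mathbb G_a^M\cdot\mathbb C v_\lambda}\subset\mathbb P(V^a_\lambda)$. With $\omega_d$ the fundamental weights, $\mathcal F^a(d_1,\dots,d_s)=\mathcal F^a_{\omega_{d_1}+\dots+\omega_{d_s}}$. Embedding into Grassmannians: $V_{\omega_d}=\Lambda^d V$ with basis $v_J=v_{j_1}\wedge\dots\wedge v_{j_d}$, $J=\{j_1<\dots<j_d\}$ and highest weight vector $v_1\wedge\dots\wedge v_d$; the vector $v_J$ lies in PBW degree $\#\{j\in J:j>d\}$, and $V^a_{\omega_d}$ is identified with $\Lambda^dV$ by identifying the class of $v_J$ with $v_J$. Under this identification $\mathcal F^a_{\omega_d}=Gr(d,n)\subset\mathbb P(\Lambda^dV)$ (Plücker embedding). For all dominant $\lambda,\mu$ there is an embedding of $G^a$-modules $V^a_{\lambda+\mu}\hookrightarrow V^a_\lambda\otimes V^a_\mu$ sending $v_{\lambda+\mu}$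 to $v_\lambda\otimes v_\mu$, which induces an embedding $\mathcal F^a_{\lambda+\mu}\hookrightarrow\mathcal F^a_\lambda\times\mathcal F^a_\mu$. Iterating gives the embedding $\mathcal F^a(d_1,\dots,d_s)\hookrightarrow\prod_{i=1}^sGr(d_i,n)$. *)

(* Defs.v *)
From HB Require Import structures.
From mathcomp Require Import all_boot all_order all_algebra.
From mathcomp Require Import reals.
From mathcomp Require Export complex.
From mathcomp Require Import mpoly.

Set Implicit Arguments.
Unset Strict Implicit.
Unset Printing Implicit Defensive.

Import GRing.Theory.
Local Open Scope ring_scope.

(* Indices are 0-based: v_{l+1} is the basis vector of index l : 'I_n, so
   "1 <= l <= i" becomes "l < i" and "j+1 <= l <= n" becomes "j <= l". *)

Section Matrices.
Variables (C : fieldType) (n : nat).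
Implicit Types x : 'M[C]_n.

Definition in_sl x : Prop := \tr x = 0.

Definition in_n x : Prop := forall i j : 'I_n, (j <= i)%N -> x i j = 0.
Definition in_h x : Prop := is_diag_mx x /\ in_sl x.
Definition in_b x : Prop :=
  in_sl x /\ forall i j : 'I_n, (j < i)%N -> x i j = 0.
Definition in_nminus x : Prop := forall i j : 'I_n, (i <= j)%N -> x i j = 0.

Definition fund_weight (d : nat) x : C := \sum_(j < n | (j < d)%N) x j j.

Definition Gr (d : nat) := {U : {vspace 'cV[C]_n} | \dim U == d}.

(* The projection pr_{i+1,j}, with kernel spanned by v_{i+1}, ..., v_j. *)
Definition pr (i j : nat) (u : 'cV[C]_n) : 'cV[C]_n :=
  \col_(l < n) (if (l < i)%N || (j <= l)%N then u l 0 else 0).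

End Matrices.

Section HighestWeightModules.
Variables (C : fieldType) (n : nat) (W : vectType C).
(* A representation of sl_n on W; the values of rho outside sl_n are never
   used. *)
Variable rho : 'M[C]_n -> 'End(W).

Definition is_sl_rep : Prop :=
  (forall (a : C) x y, in_sl x -> in_sl y ->
     rho (a *: x + y) = a *: rho x + rho y) /\
  (forall x y (w : W), in_sl x -> in_sl y ->
     rho (x *m y - y *m x) w = rho x (rho y w) - rho y (rho x w)).

Definition is_irreducible : Prop :=
  (fullv : {vspace W}) <> 0%VS /\
  forall U : {vspace W},
    (forall x, in_sl x -> (rho x @: U <= U)%VS) -> U = 0%VS \/ U = fullv.

Definition is_hw_vector (lambda : 'M[C]_n -> C) (v : W) : Prop :=
  [/\ v <> 0,
      (forall x, in_n x -> rho x v = 0)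
    & (forall h, in_h h -> rho h v = lambda h *: v)].

Definition is_irr_hw_module (lambda : 'M[C]_n -> C) (v : W) : Prop :=
  [/\ is_sl_rep, is_irreducible & is_hw_vector lambda v].

(* The products x_1 ... x_l v with l <= s and all x_i in sl_n. *)
Definition pbw_monomial (v : W) (s : nat) (w : W) : Prop :=
  exists xs : seq 'M[C]_n,
    [/\ (size xs <= s)%N, (forall x, x \in xs -> in_sl x)
      & w = foldr (fun x u => rho x u) v xs].

Definition pbw_filtration (v : W) (s : nat) (w : W) : Prop :=
  exists ws : seq W,
    (forall u, u \in ws -> pbw_monomial v s u) /\ w \in <<ws>>%VS.

End HighestWeightModules.

Section AssociatedGraded.
Variables (C : fieldType) (W A : vectType C).

(* A, with the class maps cl s : F_s -> F_s / F_{s-1} -> A, is the direct sum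
   of the quotients F_s / F_{s-1}, where F_{-1} = 0.  Only the restriction of
   cl s to F_s is meaningful. *)
Record is_assoc_graded (F : nat -> W -> Prop) (cl : nat -> 'Hom(W, A)) : Prop :=
  IsAssocGraded {
    cl_ker : forall s w, F s w ->
      (cl s w = 0 <-> if s is s'.+1 then F s' w else w = 0);
    cl_direct : forall N (w : nat -> W), (forall s, F s (w s)) ->
      \sum_(s < N) cl s (w s) = 0 -> forall s, (s < N)%N -> cl s (w s) = 0;
    cl_span : forall a : A, exists N (w : nat -> W),
      (forall s, F s (w s)) /\ a = \sum_(s < N) cl s (w s)
  }.

(* The action of g^a = b + (n^-)^a on the associated graded space; the values
   of act outside b and n^- are never used. *)
Definition is_degenerate_action (n : nat) (F : nat -> W -> Prop)
    (rho : 'M[C]_n -> 'End(W)) (cl : nat -> 'Hom(W, A))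
    (act : 'M[C]_n -> 'End(A)) : Prop :=
  forall s w, F s w ->
    (forall y, in_nminus y -> act y (cl s w) = cl s.+1 (rho y w)) /\
    (forall x, in_b x -> act x (cl s w) = cl s (rho x w)).

End AssociatedGraded.

Definition is_pbw_degeneration (C : fieldType) (n : nat) (W A : vectType C)
    (rho : 'M[C]_n -> 'End(W)) (v : W)
    (cl : nat -> 'Hom(W, A)) (act : 'M[C]_n -> 'End(A)) : Prop :=
  is_assoc_graded (pbw_filtration rho v) cl /\
  is_degenerate_action (pbw_filtration rho v) rho cl act.

Section ProjectiveClosure.
Variables (C : fieldType) (A : vectType C).

(* Points of P(A) are represented by nonzero vectors of A. *)
Definition proj_closure (S : A -> Prop) (w : A) : Prop :=
  w <> 0 /\
  forall (k : nat) (p : {mpoly C[\dim {:A}]}),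
    p \is k.-homog ->
    (forall u, S u ->
       p.@[fun i => coord (vbasis {:A}) i u] = 0) ->
    p.@[fun i => coord (vbasis {:A}) i w] = 0.

(* Exponential of a nilpotent endomorphism: f ^ k = 0 for k >= dim A. *)
Definition nil_exp (f : 'End(A)) (w : A) : A :=
  \sum_(k < (\dim {:A}).+1) (k`!%:R)^-1 *: iter k f w.

(* The abelian group G_a^M acts on A through the operators exp y, y in n^-. *)
Definition Ga_orbit (n : nat) (act : 'M[C]_n -> 'End(A)) (va w : A) : Prop :=
  exists2 y, in_nminus y & w = nil_exp (act y) va.

Definition degenerate_flag_variety (n : nat) (act : 'M[C]_n -> 'End(A))
    (va : A) : A -> Prop :=
  proj_closure (Ga_orbit act va).

End ProjectiveClosure.

(* The index sets J = {j_1 < ... < j_d}, as increasing maps. *)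
Definition index_set (n d : nat) :=
  {J : {ffun 'I_d -> 'I_n} | [forall a : 'I_d, forall b : 'I_d, (a < b)%N ==> (J a < J b)%N]}.

(* Basis of the tensor product of the Lambda^{d_i} V: (J_i)_i stands for the
   tensor product of the v_{J_i}. *)
Definition tensor_index (n s : nat) (d : 'I_s -> nat) :=
  {dffun forall i : 'I_s, index_set n (d i)}.

Section Exterior.
Variables (C : fieldType) (n : nat).

(* Lambda^d V, in coordinates with respect to the basis (v_J). *)
Definition ext (d : nat) := {ffun index_set n d -> C^o}.

(* u_1 /\ ... /\ u_d, where u_1, ..., u_d are the columns of u. *)
Definition wedge d (u : 'M[C]_(n, d)) : ext d :=
  [ffun J : index_set n d => \det (rowsub (val J) u)].

Definition plucker d (U : Gr C n d) : ext d :=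
  wedge (\matrix_(i < n, k < d) (vbasis (val U))`_k i 0).

Definition ext_hw d : ext d := wedge (\matrix_(i < n, k < d) (i == k :> nat)%:R).

Definition pbw_degree d (J : index_set n d) : nat :=
  #|[pred k : 'I_d | (d <= val J k)%N]|.

(* The coefficient of v_I in
   x . v_J = \sum_k v_{j_1} /\ ... /\ x v_{j_k} /\ ... /\ v_{j_d}. *)
Definition ext_coef d (x : 'M[C]_n) (I J : index_set n d) : C :=
  \sum_(k < d) wedge (\matrix_(i < n, b < d)
    (if b == k then x i (val J b) else (i == val J b)%:R)) I.

(* The coefficient of v_I in the component of x . v_J of PBW degree
   pbw_degree J + r: this is the action on V^a_{omega_d} = Lambda^d V of
   x in (n^-)^a for r = 1, and of x in b for r = 0. *)
Definition ext_dcoef (r : nat) d (x : 'M[C]_n) (I J : index_set n d) : C :=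
  if pbw_degree I == (pbw_degree J + r)%N then ext_coef x I J else 0.

Section Tensor.
Variables (s : nat) (d : 'I_s -> nat).

Definition ext_tensor := {ffun tensor_index n d -> C^o}.

Definition tens (p : forall i, ext (d i)) : ext_tensor :=
  [ffun J : tensor_index n d => \prod_i (p i (J i) : C)].

Definition replace_index (J : tensor_index n d) (i : 'I_s)
    (K : index_set n (d i)) : tensor_index n d :=
  finfun (dfwith (fun k => J k) K).

(* Leibniz rule: x acts on each tensor factor in turn. *)
Definition tens_act (r : nat) (x : 'M[C]_n) (t : ext_tensor) : ext_tensor :=
  [ffun J : tensor_index n d => \sum_i \sum_(K : index_set n (d i))
     ext_dcoef r x (J i) K * (t (replace_index J K) : C)].

(* The embeddings of g^a-modules (equivalently, of G^a-modules) of A into the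
   tensor product of the V^a_{omega_{d_i}} that send va to the tensor product
   of the highest weight vectors. *)
Definition is_degenerate_embedding (A : vectType C) (act : 'M[C]_n -> 'End(A))
    (va : A) (phi : 'Hom(A, ext_tensor)) : Prop :=
  [/\ lker phi = 0%VS,
      phi va = tens (fun i => ext_hw (d i)),
      (forall y a, in_nminus y -> phi (act y a) = tens_act 1 y (phi a))
    & (forall x a, in_b x -> phi (act x a) = tens_act 0 x (phi a))].

(* The embedding of F^a in the product of the Gr(d_i, n) induced by phi, as a
   relation: the point [phi w] is the image of (V_1, ..., V_s) under the
   Pluecker embeddings followed by the Segre embedding. *)
Definition maps_to (A : vectType C) (phi : 'Hom(A, ext_tensor)) (w : A)
    (V : forall i, Gr C n (d i)) : Prop :=
  exists2 c : C, c <> 0 & phi w = c *: tens (fun i => plucker (V i)).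

End Tensor.
End Exterior.

(* Main.v *)
Require Import Defs.
From HB Require Import structures.
From mathcomp Require Import all_boot all_order all_algebra.
From mathcomp Require Import reals complex.
From mathcomp Require Import perm mpoly zify.

(* In the affine chart given by the highest weight vectors, exp y sends the
   highest weight point to the tuple of the graphs of the blocks
   (y_{ij})_{i > d_l >= j}, and the tuples (V_l) satisfying the incidence
   conditions and meeting this chart are exactly the points of the orbit.

   Closure => conditions: near a nonvanishing coordinate J of the tensor product,
   the Pluecker and Segre relations and the incidence conditions are homogeneous
   equations in matrices that depend linearly on the point; they hold on the orbit
   and hence on its closure.

   Conditions => closure: let P_l, I_l be the spans of v_1 .. v_{d_l} and of
   v_{d_l+1} .. v_n.  The defects dim (V_l :&: I_l) vanish exactly when (V_l) is in
   the orbit.  Otherwise the representations (V_l :&: I_l)_l and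
   (P_l / pi V_l)_l of the linear quiver have the same nonzero dimension vector,
   so there is an interval [a, b] on which both are constant, such that the former
   acquires a new vector at a and the latter loses one after b.  A rank one map
   supported on [a, b] gives a line V_l(z) = (1 + z B_l) V_l of solutions with
   smaller total defect for z <> 0, and one concludes by induction since V = V(0)
   is a limit. *)

Import GRing.Theory Num.Theory.
Local Open Scope ring_scope.

Set Implicit Arguments.
Unset Strict Implicit.
Unset Printing Implicit Defensive.

(** * Index sets and alternating sums *)

Section IndexSets.
Variables n d : nat.

Lemma index_set_mono (J : index_set n d) (a b : 'I_d) :
  (a < b)%N -> (val J a < val J b)%N.
Proof. by move=> ab; have /forallP/(_ a)/forallP/(_ b)/implyP := valP J; exact. Qed.

Lemma index_set_inj (J : index_set n d) : injective (val J).
Proof.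
move=> a b e; apply: ord_inj; case: (ltngtP a b) => // ab;
by have := index_set_mono J ab; rewrite e ltnn.
Qed.

Lemma inj_sort (f : 'I_d -> 'I_n) : injective f ->
  exists J : index_set n d, exists s : 'S_d, forall k, f k = val J (s k).
Proof.
move=> fi; pose t := [tuple f i | i < d].
pose leI (x y : 'I_n) := (x <= y)%N.
have sz : size (sort leI t) == d by rewrite size_sort size_tuple.
pose u := Tuple sz.
have /tuple_permP[s ts] : perm_eq t u by rewrite perm_sym perm_sort.
pose J := [ffun k => tnth u k].
have ut : uniq u by rewrite sort_uniq map_inj_uniq ?enum_uniq.
have su : sorted (fun x y : 'I_n => (x < y)%N) u.
  have : sorted leI u by apply: sort_sorted => x y; exact: leq_total.
  have -> : sorted leI u = sorted leq (map val (u : seq 'I_n)) by rewrite sorted_map.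
  rewrite -[sorted (fun _ _ => _) u]/(sorted (relpre val ltn) u) -sorted_map ltn_sorted_uniq_leq.
  by rewrite map_inj_uniq ?ut //; exact: val_inj.
have JE k : J k = tnth u k by rewrite ffunE.
have JP : [forall a : 'I_d, forall b : 'I_d, (a < b)%N ==> (J a < J b)%N].
  apply/forallP => a; apply/forallP => b; apply/implyP => ab; rewrite 2!JE.
  rewrite !(tnth_nth (f a)).
  apply: (sorted_ltn_nth (leT := fun x y : 'I_n => (x < y)%N)) => //.
  - by move=> x y z; apply: ltn_trans.
  - by rewrite inE size_tuple.
  - by rewrite inE size_tuple.
exists (exist _ J JP), s => k; rewrite [val _]/= JE.
have := congr1 (fun w : d.-tuple _ => tnth w k) (val_inj ts).
by rewrite !tnth_mktuple.
Qed.

(** Both sides have the same image, and an increasing map is the sorted list of its image. With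
    [inj_sort], every injective map is an index set after a permutation, in a unique way. *)
Lemma index_set_perm_inj (J K : index_set n d) (s t : 'S_d) :
  (forall k, val J (s k) = val K (t k)) -> J = K /\ s = t.
Proof.
move=> e; suff JK : J = K.
  by split=> //; apply/permP => k; apply: (@index_set_inj K); rewrite -e JK.
apply: val_inj.
have srt (L : index_set n d) :
    sorted (fun x y : 'I_n => (x < y)%N) [seq val L i | i <- enum 'I_d].
  rewrite sorted_map.
  have : sorted ltn (map val (enum 'I_d)) by rewrite val_enum_ord iota_ltn_sorted.
  rewrite sorted_map; apply: sub_sorted => a b; exact: index_set_mono.
have eqs : [seq val J i | i <- enum 'I_d] = [seq val K i | i <- enum 'I_d].
  apply: (irr_sorted_eq (leT := fun x y : 'I_n => (x < y)%N)) => //.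
  - by move=> x y z; apply: ltn_trans.
  - by move=> x; rewrite /= ltnn.
  move=> x; apply/mapP/mapP => -[k _ ->].
    exists (t ((s^-1)%g k)); first by rewrite mem_enum.
    by rewrite -e permKV.
  exists (s ((t^-1)%g k)); first by rewrite mem_enum.
  by rewrite e permKV.
by apply/ffunP => k; move/eq_in_map: eqs; apply; rewrite mem_enum.
Qed.

End IndexSets.

(** * Multilinear expansion of determinants over index sets *)

Section Expansion.
Variables (R : comNzRingType) (n d : nat).

(** Column [b] is the combination of the vectors [B b _ j] with coefficients [u j b]. Transposing
    makes the Leibniz products run over columns, so that they distribute over these sums. *)
Lemma det_col_expand (m : nat) (u : 'M[R]_(n, m)) (B : 'I_m -> 'I_m -> 'I_n -> R) :
  \det (\matrix_(a, b) \sum_j u j b * B b a j) =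
  \sum_(f : {ffun 'I_m -> 'I_n})
     (\prod_b u (f b) b) * \det (\matrix_(a, b) B b a (f b)).
Proof.
rewrite -det_tr /determinant.
under eq_bigr => s _.
  under eq_bigr => b _ do rewrite !mxE.
  rewrite bigA_distr_bigA big_distrr /=.
  under eq_bigr => f _ do rewrite big_split /= mulrCA.
  over.
rewrite exchange_big /=; apply: eq_bigr => f _.
rewrite -[X in _ = _ * X]det_tr /determinant big_distrr /=.
by apply: eq_bigr => s _; congr (_ * (_ * _)); apply: eq_bigr => b _; rewrite !mxE.
Qed.

(** Non-injective maps contribute nothing, and each injective one is [val J \o s] for unique [J] and
    [s]. For fixed [J] the signs of [F] turn the sum over [s] into the Leibniz formula. *)
Lemma sum_alternating (u : 'M[R]_(n, d)) (F : ('I_d -> 'I_n) -> R) :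
  (forall f g, f =1 g -> F f = F g) ->
  (forall f (s : 'S_d), F (f \o s) = (-1) ^+ s * F f) ->
  (forall f, ~ injective f -> F f = 0) ->
  \sum_(f : {ffun 'I_d -> 'I_n}) (\prod_b u (f b) b) * F f =
  \sum_(J : index_set n d) \det (rowsub (val J) u) * F (val J).
Proof.
move=> Fext Fs F0.
rewrite (bigID (fun f : {ffun 'I_d -> 'I_n} => injectiveb f)) /= addrC big1 ?add0r; last first.
  by move=> f /injectiveP fi; rewrite F0 ?mulr0.
pose h (p : index_set n d * 'S_d) : {ffun 'I_d -> 'I_n} := [ffun k => val p.1 (p.2 k)].
have hi : injective h.
  move=> [J s] [K t] /ffunP e.
  have [k|-> ->] // := @index_set_perm_inj n d J K s t.
  by have := e k; rewrite !ffunE.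
have im (f : {ffun 'I_d -> 'I_n}) : injectiveb f = (f \in [set h p | p in predT]).
  apply/injectiveP/imsetP => [/inj_sort[J [s e]]|[p _ ->] a b].
    by exists (J, s) => //; apply/ffunP => k; rewrite ffunE /= e.
  by rewrite !ffunE => /index_set_inj /perm_inj.
rewrite (eq_bigl _ _ im) big_imset /=; last by move=> p q _ _; apply: hi.
rewrite -(pair_big predT predT
  (fun J s => (\prod_b u (h (J, s) b) b) * F (h (J, s)))) /=.
apply: eq_bigr => J _; rewrite -det_tr /determinant big_distrl /=.
apply: eq_bigr => s _.
rewrite (Fext _ (val J \o s)); last by move=> k; rewrite ffunE.
rewrite Fs mulrA [_ * (-1) ^+ _]mulrC; congr (_ * _ * _).
by apply: eq_bigr => b _; rewrite !mxE ffunE.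
Qed.

Lemma det_rowsub_perm m (f : 'I_d -> 'I_m) (s : 'S_d) (u : 'M[R]_(m, d)) :
  \det (rowsub (f \o s) u) = (-1) ^+ s * \det (rowsub f u).
Proof.
rewrite rowsub_comp -row_permEsub row_permE det_mulmx det_perm //.
Qed.

End Expansion.

(** * The degenerate action on exterior powers *)

Section PolyDerivative.
Variable R : comNzRingType.

Lemma deriv_prod (I : finType) (F : I -> {poly R}) :
  (\prod_i F i)^`() = \sum_i (F i)^`() * \prod_(j | j != i) F j.
Proof.
suff H (r : seq I) : uniq r ->
    (\prod_(i <- r) F i)^`() = \sum_(i <- r) (F i)^`() * \prod_(j <- r | j != i) F j.
  by apply: H; apply: index_enum_uniq.
elim: r => [_|x r IH /= /andP[xr ur]]; first by rewrite !big_nil derivC.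
rewrite !big_cons derivM IH // eqxx /=; congr (_ + _).
  congr (_ * _); rewrite big_seq [RHS]big_seq_cond; apply: eq_bigl => j.
  by case jr: (j \in r) => //=; apply/esym; apply: contraNneq xr => <-.
rewrite big_distrr /= big_seq [RHS]big_seq; apply: eq_bigr => i ir.
rewrite big_cons; have -> : x != i by apply: contraNneq xr => ->.
by rewrite mulrCA.
Qed.

Lemma deriv_det d (A : 'M[{poly R}]_d) :
  (\det A)^`() =
  \sum_k \det (\matrix_(a, b) if b == k then (A a b)^`() else A a b).
Proof.
rewrite -det_tr /determinant raddf_sum /=.
under eq_bigr => s _.
  rewrite raddfMsign /= deriv_prod big_distrr /=.
  over.
rewrite exchange_big; apply: eq_bigr => k _.
rewrite -[RHS]det_tr /determinant; apply: eq_bigr => s _; congr (_ * _).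
rewrite [RHS](bigD1 k) //= !mxE eqxx; congr (_ * _).
by apply: eq_bigr => b bk; rewrite !mxE (negbTE bk).
Qed.

End PolyDerivative.

Section DegenerateAction.
Variables (C : numFieldType) (n d : nat).
Implicit Types (I J K : index_set n d).

(** The component of [y] from the span of the first [d] basis vectors to the span of the others; it
    is all that is left of [y] in the degenerate action on the [d]-th exterior power. *)
Definition low_block (y : 'M[C]_n) : 'M[C]_n :=
  \matrix_(i, j) (if (d <= i)%N && (j < d)%N then y i j else 0).

Lemma low_block_sqr y : low_block y *m low_block y = 0.
Proof.
apply/matrixP => i j; rewrite !mxE big1 // => k _; rewrite !mxE.
by case: (ltnP k d) => kd; rewrite ?andbF ?mul0r //= mulr0.
Qed.

Lemma pbw_degreeE (J : index_set n d) :
  pbw_degree J = (\sum_k (d <= val J k)%N)%N.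
Proof. by rewrite /pbw_degree -sum1_card big_mkcond. Qed.

(** In the Leibniz expansion the term of [s] survives only if [I] agrees with [J \o s] away from
    [a0], the position that [s] sends to [k]. The PBW degree of [I] then exceeds that of [J] by one
    exactly when the entry of [y] used there carries an index below [d] to one not below [d]. *)
Lemma ext_dcoefE (y : 'M[C]_n) I J :
  ext_dcoef 1 y I J = ext_coef (low_block y) I J.
Proof.
rewrite /ext_dcoef /ext_coef.
have -> (e : C) (b : bool) : (if b then e else 0) = b%:R * e.
  by case: b; rewrite ?mul1r ?mul0r.
rewrite big_distrr /=; apply: eq_bigr => k _.
rewrite !ffunE /determinant big_distrr /=; apply: eq_bigr => s _.
rewrite mulrCA; congr (_ * _).
pose a0 := (s^-1)%g k.
have sa a : (s a == k) = (a == a0).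
  by rewrite /a0; apply/eqP/eqP => [<-|->]; rewrite ?permK ?permKV.
rewrite (bigD1 a0) // [in RHS](bigD1 a0) //= !mxE sa eqxx.
under eq_bigr => a aa0 do rewrite !mxE sa (negbTE aa0).
under [in RHS]eq_bigr => a aa0 do rewrite !mxE sa (negbTE aa0).
rewrite mulrA.
have [/forallP e|/forallPn[a]] :=
    boolP [forall a, (a != a0) ==> (val I a == val J (s a))]; last first.
  rewrite negb_imply => /andP[aa0 ne].
  have -> : \prod_(i < d | i != a0) (val I i == val J (s i))%:R = 0 :> C.
    by rewrite (bigD1 a) //= (negbTE ne) mul0r.
  by rewrite !mulr0.
congr (_ * _); rewrite !pbw_degreeE [in X in _ == X](reindex_inj (@perm_inj _ s)) /=.
rewrite (bigD1 a0) //= [X in _ == (X + 1)%N](bigD1 a0) //= /a0 permKV.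
rewrite (eq_bigr (fun i => (d <= val J (s i))%N : nat)); last first.
  by move=> a aa0; have /implyP/(_ aa0)/eqP -> := e a.
rewrite addnAC eqn_add2r.
case: (leqP d (val J k)) => jd; case: (leqP d (val I _)) => id /=;
  by rewrite ?mul0r ?mul1r.
Qed.

Lemma ext_coefE (x : 'M[C]_n) I J : ext_coef x I J =
  \sum_k \det (\matrix_(a, b) (if b == k then x (val I a) (val J b) else
     (val I a == val J b)%:R)).
Proof.
apply: eq_bigr => k _; rewrite ffunE; congr (\det _).
by apply/matrixP => a b; rewrite !mxE.
Qed.

(** If the columns solve the linear equation [U' = x U], their wedge product solves the one given by
    the action of [x] on the exterior power. Expanding the differentiated columns gives a sum over
    all maps [f], which [sum_alternating] reduces to index sets. *)
Lemma wedge_deriv (x : 'M[C]_n) (U : 'M[{poly C}]_(n, d)) I :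
  (forall i k, (U i k)^`() = (map_mx polyC x *m U) i k) ->
  (\det (rowsub (val I) U))^`() =
  \sum_K ext_coef x I K *: \det (rowsub (val K) U).
Proof.
move=> dU; rewrite deriv_det.
pose B k (b : 'I_d) (a : 'I_d) (j : 'I_n) : C :=
  if b == k then x (val I a) j else (val I a == j)%:R.
pose F (f : 'I_d -> 'I_n) : C := \sum_k \det (\matrix_(a, b) B k b a (f b)).
have -> : \sum_k \det (\matrix_(a, b)
      (if b == k then (rowsub (val I) U a b)^`() else rowsub (val I) U a b)) =
    \sum_(f : {ffun 'I_d -> 'I_n}) (\prod_b U (f b) b) * (F f)%:P.
  under [RHS]eq_bigr => f _ do rewrite /F raddf_sum big_distrr /=.
  rewrite [RHS]exchange_big; apply: eq_bigr => k _.
  under [RHS]eq_bigr => f _ do rewrite -det_map_mx.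
  transitivity (\det (\matrix_(a, b) \sum_j U j b * (B k b a j)%:P)).
    congr (\det _); apply/matrixP => a b; rewrite !mxE /B.
    case: eqP => _.
      by rewrite dU !mxE; apply: eq_bigr => j _; rewrite !mxE mulrC.
    rewrite (bigD1 (val I a)) //= eqxx mulr1 big1 ?addr0 // => j ji.
    by rewrite eq_sym (negbTE ji) mulr0.
  rewrite (det_col_expand U (fun b a j => (B k b a j)%:P)).
  apply: eq_bigr => f _; congr (_ * \det _).
  by apply/matrixP => a b; rewrite !mxE.
have Fext f g : f =1 g -> F f = F g.
  by move=> e; apply: eq_bigr => k _; congr (\det _); apply/matrixP => a b; rewrite !mxE e.
have Fs f (s : 'S_d) : F (f \o s) = (-1) ^+ s * F f.
  rewrite /F (reindex_inj (@perm_inj _ (s^-1)%g)) big_distrr /=.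
  apply: eq_bigr => k _.
  set M := (X in _ = _ * \det X).
  rewrite -(det_tr M) -[M^T](mxsub_id) -[mxsub _ _ _]/(rowsub id M^T) -det_rowsub_perm -det_tr.
  congr (\det _); apply/matrixP => b a; rewrite !mxE /= /B.
  by rewrite (canF_eq (permK s)).
(* When [f a = f b], the terms of [F f] need not vanish one by one; the transposition of [a] and [b]
   gives [F f = - F f], and characteristic zero concludes. *)
have F0 f : ~ injective f -> F f = 0.
  move=> fi; have /injectivePn[a [b ab e]] : ~~ injectiveb f by apply/injectiveP.
  have : F f = - F f.
    rewrite -mulN1r; have <- : (-1) ^+ (tperm a b) = -1 :> C.
      by rewrite odd_tperm ab expr1.
    rewrite -Fs; apply: Fext => k /=.
    by case: tpermP => // ->.
  move/eqP; rewrite -subr_eq0 opprK -mulr2n mulrn_eq0 /=; by move/eqP.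
rewrite (@sum_alternating _ _ _ U (fun f => (F f)%:P)); last first.
- by move=> f /F0 ->.
- by move=> f s; rewrite Fs polyCM rmorphXn rmorphN1.
- by move=> f g /Fext ->.
apply: eq_bigr => K _; rewrite mulrC mul_polyC; congr (_ *: _).
by rewrite ext_coefE.
Qed.

End DegenerateAction.

(** * Exponentials and the orbit *)

Section Nilpotent.
Variables (C : fieldType) (A : vectType C).
Implicit Types (f : 'End(A)) (U : {vspace A}).

(** Induction on the dimension bound: either [f] maps [U] onto itself, so that [U] equals its image
    under the [N]-th iterate, which is zero, or the image of [U] has smaller dimension. *)
Lemma nilpotent_iter f U N k : (f @: U <= U)%VS ->
  (forall u, u \in U -> iter N f u = 0) -> (\dim U <= k)%N ->
  forall u, u \in U -> iter k f u = 0.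
Proof.
elim: k U => [|k IH] U fU f0 dU u uU.
  by apply/eqP; rewrite -memv0 -(eqP (_ : U == 0%VS)) // -dimv_eq0 -leqn0.
have [fUU|fUU] := boolP (U <= f @: U)%VS.
  have img m : (U <= iter m (fun V => f @: V) U)%VS.
    by elim: m => //= m IHm; apply: subv_trans fUU _; apply: limgS.
  have im0 m w : w \in iter m (fun V => f @: V)%VS U ->
      exists2 v, v \in U & w = iter m f v.
    elim: m w => [|m IHm] w /=; first by exists w.
    by case/memv_imgP => x /IHm[v vU ->] ->; exists v.
  have [v vU ->] := im0 N u (subvP (img N) _ uU).
  by rewrite f0 //; elim: k.+1 => //= m ->; rewrite linear0.
rewrite iterSr; apply: (IH (f @: U)%VS); first exact: limgS.
- by move=> w wU; apply: f0; apply: (subvP fU).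
- have dlt : (\dim (f @: U) < \dim U)%N.
    rewrite ltn_neqAle dimvS // andbT; apply: contraNneq fUU => e.
    have /eqP -> : (f @: U == U)%VS by rewrite eqEdim fU e /=.
    exact: subvv.
  by rewrite -ltnS; apply: leq_trans dlt dU.
- exact: memv_img.
Qed.

(** The kernel of the [N]-th iterate is stable under [f] and contains [v]. The bound matches the
    truncation in [nil_exp]. *)
Lemma nilpotent_iter_dim f v N k :
  iter N f v = 0 -> (\dim {:A} <= k)%N -> iter k f v = 0.
Proof.
move=> fv dk.
pose g : 'End(A) := iter N (fun g => (f \o g)%VF) \1%VF.
have gE m u : (iter m (fun g => (f \o g)%VF) \1%VF : 'End(A)) u = iter m f u.
  by elim: m => [|m IH] /=; rewrite ?id_lfunE // comp_lfunE IH.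
apply: (@nilpotent_iter f (lker g) N).
- apply/subvP => _ /memv_imgP[u ug ->]; move: ug; rewrite !memv_ker /g !gE.
  by rewrite -iterSr /= => /eqP ->; rewrite linear0.
- by move=> u; rewrite memv_ker /g gE => /eqP.
- by apply: leq_trans dk; apply: dimvS; apply: subvf.
- by rewrite memv_ker /g gE fv.
Qed.

End Nilpotent.

Section Exponential.
Variables (C : numFieldType) (n s : nat) (d : 'I_s -> nat).
Implicit Types (y : 'M[C]_n) (J : tensor_index n d).

Definition hw_mx (e : nat) : 'M[C]_(n, e) := \matrix_(i, k) (i == k :> nat)%:R.

(* The columns span the graph of the block of y. *)
Definition graph_mx e y : 'M[C]_(n, e) := hw_mx e + low_block e y *m hw_mx e.

(** The exponential of ['X] times the block of [y], applied to the highest weight columns; it is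
    affine in ['X] because the block squares to zero. *)
Definition graph_curve e y : 'M[{poly C}]_(n, e) :=
  map_mx polyC (hw_mx e) + 'X *: map_mx polyC (low_block e y *m hw_mx e).

Definition tens_curve y J : {poly C} :=
  \prod_i \det (rowsub (val (J i)) (graph_curve (d i) y)).

Lemma graph_curve_deriv e y i k :
  (graph_curve e y i k)^`() = (map_mx polyC (low_block e y) *m graph_curve e y) i k.
Proof.
rewrite /graph_curve mulmxDr -scalemxAr -!map_mxM mulmxA low_block_sqr mul0mx.
rewrite map_mx0 scaler0 addr0 ![in RHS]mxE !mxE derivD derivM derivX !derivC.
by rewrite add0r mulr0 addr0 mul1r.
Qed.

Lemma wedge_curve e y (J : index_set n e) z :
  (\det (rowsub (val J) (graph_curve e y))).[z] =
  wedge (hw_mx e + z *: (low_block e y *m hw_mx e)) J.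
Proof.
rewrite ffunE -horner_evalE -det_map_mx; congr (\det _).
apply/matrixP => a b; rewrite !mxE /= /horner_eval !hornerE.
by [].

Qed.

Lemma tens_curve_eval y z J : (tens_curve y J).[z] =
  tens (fun i => wedge (hw_mx (d i) + z *: (low_block (d i) y *m hw_mx (d i)))) J.
Proof.
by rewrite ffunE horner_prod; apply: eq_bigr => i _; rewrite wedge_curve.
Qed.

Lemma replace_index_in J i (K : index_set n (d i)) : replace_index J K i = K.
Proof. by rewrite ffunE dfwith_in. Qed.

Lemma replace_index_out J i (K : index_set n (d i)) j :
  i != j -> replace_index J K j = J j.
Proof. by move=> ij; rewrite ffunE dfwith_out. Qed.

(** The product rule over the tensor factors is the Leibniz rule of [tens_act]: the curve solves the
    differential equation of the exponential, which links its successive coefficients. *)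
Lemma tens_curve_deriv y J : (tens_curve y J)^`() =
  \sum_i \sum_(K : index_set n (d i))
     ext_dcoef 1 y (J i) K *: tens_curve y (replace_index J K).
Proof.
rewrite /tens_curve deriv_prod; apply: eq_bigr => i _.
rewrite (wedge_deriv _ (@graph_curve_deriv (d i) y)) big_distrl /=.
apply: eq_bigr => K _; rewrite ext_dcoefE -scalerAl; congr (_ *: _).
rewrite [RHS](bigD1 i) //= replace_index_in; congr (_ * _).
by apply: eq_bigr => j ji; rewrite replace_index_out // eq_sym.
Qed.

Definition tens_coef y k : ext_tensor C n d := [ffun J => (tens_curve y J)`_k].

Lemma tens_act_coef y k :
  tens_act 1 y (tens_coef y k) = k.+1%:R *: tens_coef y k.+1.
Proof.
apply/ffunP => J; rewrite !ffunE.
transitivity ((tens_curve y J)^`()`_k); last first.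
  by rewrite coef_deriv -[LHS]mulr_natl.
rewrite tens_curve_deriv coef_sum; apply: eq_bigr => i _.
by rewrite coef_sum; apply: eq_bigr => K _; rewrite coefZ ffunE.
Qed.

Lemma tens_actZ r y c (t : ext_tensor C n d) :
  tens_act r y (c *: t) = c *: tens_act r y t.
Proof.
apply/ffunP => J; rewrite !ffunE [RHS]big_distrr /=; apply: eq_bigr => i _.
by rewrite big_distrr /=; apply: eq_bigr => K _; rewrite !ffunE mulrCA.
Qed.

Lemma iter_tens_act y k :
  iter k (tens_act 1 y) (tens_coef y 0) = k`!%:R *: tens_coef y k.
Proof.
elim: k => [|k IH] /=; first by rewrite scale1r.
by rewrite IH tens_actZ tens_act_coef scalerA factS mulnC natrM.
Qed.

Variables (A : vectType C) (act : 'M[C]_n -> 'End(A)) (va : A).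
Variable phi : 'Hom(A, ext_tensor C n d).
Hypothesis phiP : is_degenerate_embedding act va phi.

Lemma embedding_inj : injective phi.
Proof. by case: phiP => /eqP/lker0P. Qed.

(** The [k]-th coefficient of the curve is [y] applied [k] times to the highest weight tensor,
    divided by [k!]; so the exponential series is the value of the curve at 1. *)
Lemma embedding_nil_exp y : in_nminus y ->
  phi (nil_exp (act y) va) = tens (fun i => wedge (graph_mx (d i) y)).
Proof.
move=> yn; have [_ pva pact _] := phiP.
have hw0 : phi va = tens_coef y 0.
  rewrite pva; apply/ffunP => J; rewrite ffunE [RHS]ffunE -horner_coef0.
  rewrite tens_curve_eval ffunE; apply: eq_bigr => i _.
  by rewrite scale0r addr0.
have pit k : phi (iter k (act y) va) = k`!%:R *: tens_coef y k.
  rewrite -iter_tens_act; elim: k => [|k IH] //=.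
  by rewrite pact // IH.
pose N := (\max_J size (tens_curve y J))%N.
have coef0 k : (N <= k)%N -> tens_coef y k = 0.
  move=> Nk; apply/ffunP => J; rewrite !ffunE nth_default //.
  by apply: leq_trans Nk; apply: (leq_bigmax J).
(* Nilpotency is transported from the target: the coefficients vanish from [N] on and [phi] is
   injective, so the iterates on [va] vanish from [\dim {:A}] on, and with them the coefficients. *)
have nil k : (\dim {:A} <= k)%N -> tens_coef y k = 0.
  move=> dk; have e : iter k (act y) va = 0.
    apply: (@nilpotent_iter_dim _ _ _ _ N) => //.
    by apply: embedding_inj; rewrite pit coef0 // scaler0 linear0.
  have := pit k; rewrite e linear0 => /esym/eqP.
  by rewrite scaler_eq0 pnatr_eq0 -leqn0 leqNgt fact_gt0 => /eqP.
rewrite /nil_exp linear_sum /=.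
transitivity (\sum_(k < (\dim {:A}).+1) tens_coef y k).
  apply: eq_bigr => k _; rewrite linearZ /= pit scalerA mulVf ?scale1r //.
  by rewrite pnatr_eq0 -leqn0 leqNgt fact_gt0.
transitivity (\sum_(k < maxn N (\dim {:A}).+1) tens_coef y k).
  rewrite (big_ord_widen _ (tens_coef y) (leq_maxr N _)) big_mkcond /=.
  by apply: eq_bigr => k _; case: ltnP => // /ltnW/nil.
transitivity (\sum_(k < N) tens_coef y k).
  rewrite (big_ord_widen _ (tens_coef y) (leq_maxl N (\dim {:A}).+1)).
  rewrite [RHS]big_mkcond /=.
  by apply: eq_bigr => k _; case: ltnP => // /coef0.
apply/ffunP => J; rewrite sum_ffunE.
transitivity ((tens_curve y J).[1]); last first.
  by rewrite tens_curve_eval !ffunE; apply: eq_bigr => i _; rewrite scale1r.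
rewrite (@horner_coef_wide _ N); last by apply: (leq_bigmax J).
by apply: eq_bigr => k _; rewrite ffunE expr1n mulr1.
Qed.

End Exponential.

(** * Pluecker coordinates *)

Section Plucker.
Variables (C : fieldType) (n d : nat).
Implicit Types (u : 'M[C]_(n, d)) (U : {vspace 'cV[C]_n}).

(* The coefficient of v_{f 0} /\ ... /\ v_{f (d-1)} in p, for an arbitrary,
   not necessarily increasing, f. *)
Definition alt_coord (p : ext C n d) (f : 'I_d -> 'I_n) : C :=
  \sum_J (p J : C) * \det (rowsub f (\matrix_(i, b) (i == val J b)%:R : 'M[C]_(n, d))).

Lemma alt_coord_wedge u f : alt_coord (wedge u) f = \det (rowsub f u).
Proof.
pose F (g : 'I_d -> 'I_n) : C :=
  \det (rowsub f (\matrix_(i, b) (i == g b)%:R : 'M[C]_(n, d))).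
transitivity (\sum_(J : index_set n d) \det (rowsub (val J) u) * F (val J)).
  by apply: eq_bigr => J _; rewrite ffunE.
rewrite -sum_alternating; last first.
- move=> g gi; have /injectivePn[a [b ab e]] : ~~ injectiveb g by apply/injectiveP.
  rewrite /F -det_tr; apply: (determinant_alternate ab) => k.
  by rewrite !mxE e.
- move=> g s; rewrite /F.
  rewrite -[X in _ = _ * X]det_tr -[X in _ = _ * \det X]mxsub_id -det_rowsub_perm -det_tr.
  by congr (\det _); apply/matrixP => a b; rewrite !mxE.
- move=> g h e; rewrite /F; congr (\det _); apply/matrixP => a b.
  by rewrite !mxE e.
transitivity (\det (\matrix_(a, b) \sum_j u j b * (f a == j)%:R)).
  rewrite (det_col_expand u (fun b a j => (f a == j)%:R)).
  apply: eq_bigr => g _; congr (_ * \det _).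
  by apply/matrixP => a b; rewrite !mxE.
congr (\det _); apply/matrixP => a b; rewrite !mxE (bigD1 (f a)) //= eqxx.
rewrite mulr1 big1 ?addr0 // => j jf.
by rewrite eq_sym (negbTE jf) mulr0.
Qed.

Lemma wedge_mulmx u (g : 'M_d) : wedge (u *m g) = \det g *: wedge u.
Proof.
apply/ffunP => J; rewrite !ffunE -mul_rowsub_mx det_mulmx mulrC.
by [].
Qed.

(** The columns are independent, so some [d] rows form an invertible matrix; sorting these rows
    changes the minor by a sign only. *)
Lemma wedge_neq0 u : (forall c : 'cV_d, u *m c = 0 -> c = 0) ->
  exists J, wedge u J <> 0.
Proof.
move=> ui; have fA : row_full u.
  rewrite -[row_full u]/(\rank u == d) -mxrank_tr -[_ == d]/(row_free u^T) -kermx_eq0.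
   apply/eqP/row_matrixP => i; rewrite row0.
  apply/trmx_inj; rewrite trmx0; apply: ui.
  by apply: trmx_inj; rewrite trmx_mul trmxK -row_mul mulmx_ker row0 trmx0.
have [J [s Js]] := inj_sort (@fullrankfun_inj _ _ _ _ fA).
exists J; rewrite ffunE => J0.
have := fullrowsub_unit fA; rewrite unitmxE unitfE.
have -> : rowsub (fullrankfun fA) u = rowsub (val J \o s) u.
  by apply/matrixP => a b; rewrite !mxE Js.
by rewrite det_rowsub_perm J0 mulr0 eqxx.
Qed.

Definition basis_mx (e : nat) U : 'M[C]_(n, e) := \matrix_(i, k) (vbasis U)`_k i 0.

Lemma basis_mxM U (c : 'cV_d) : basis_mx d U *m c = \sum_k c k 0 *: (vbasis U)`_k.
Proof.
apply/colP => i; rewrite mxE summxE; apply: eq_bigr => k _.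
by rewrite !mxE mulrC.
Qed.

End Plucker.

Section Plucker2.
Variables (C : fieldType) (n : nat) (U : {vspace 'cV[C]_n}) (d : nat).
Hypothesis dimU : \dim U = d.
Implicit Types (u : 'M[C]_(n, d)).

Lemma basis_mx_inj (c : 'cV_d) : basis_mx d U *m c = 0 -> c = 0.
Proof.
case: d / dimU c => c; rewrite basis_mxM => e.
apply/colP => k; rewrite mxE.
have /freeP/(_ (fun k => c k 0) e k) := basis_free (vbasisP U).
by [].
Qed.

Lemma basis_mx_span x : x \in U -> exists c : 'cV_d, x = basis_mx d U *m c.
Proof.
case: d / dimU => xU; exists (\col_k coord (vbasis U) k x).
rewrite basis_mxM {1}(coord_vbasis xU); apply: eq_bigr => k _.
by rewrite mxE.
Qed.

Lemma basis_mx_mem (c : 'cV_d) : basis_mx d U *m c \in U.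
Proof.
rewrite basis_mxM; apply: rpred_sum => k _; apply: rpredZ.
by apply: vbasis_mem; apply: mem_nth; rewrite size_tuple dimU.
Qed.

Lemma wedge_basis u : (forall k, col k u \in U) -> (exists J, wedge u J <> 0) ->
  exists2 c : C, c <> 0 & wedge u = c *: wedge (basis_mx d U).
Proof.
move=> uU [J uJ].
have /fin_all_exists[g gP] k : exists c : 'cV_d, col k u = basis_mx d U *m c.
  exact: basis_mx_span.
have ug : u = basis_mx d U *m (\matrix_(a, k) g k a 0).
  apply/matrixP => a k; have := congr1 (fun c : 'cV_n => c a 0) (gP k).
  by rewrite mxE => ->; rewrite !mxE; apply: eq_bigr => b _; rewrite !mxE.
exists (\det (\matrix_(a, k) g k a 0)); last by rewrite {1}ug wedge_mulmx.
by move=> g0; apply: uJ; rewrite ug wedge_mulmx g0 scale0r ffunE.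
Qed.

Lemma wedge_basis_neq0 : exists J, wedge (basis_mx d U) J <> 0.
Proof. by apply: wedge_neq0; exact: basis_mx_inj. Qed.

End Plucker2.

(** * Affine charts around a nonvanishing coordinate *)

Section Chart.
Variables (C : fieldType) (n s : nat) (d : 'I_s -> nat).
Implicit Types (t : ext_tensor C n d) (J : tensor_index n d).

(* On t = p_1 (x) ... (x) p_s the columns of chart_mx t J i span the subspace
   with Pluecker vector p_i, provided that t J <> 0; it is linear in t. *)
Definition chart_mx t J i : 'M[C]_(n, d i) :=
  \matrix_(a, k) alt_coord [ffun K : index_set n (d i) => t (replace_index J K)]
                   (fun b => if b == k then a else val (J i) b).

(** Cramer's rule: replacing row [k] of the [J i] block of [u i] by row [a] of [u i] and expanding
    along it gives an entry of [u i] times the adjugate of the block. The scalar [c] and the other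
    tensor factors make up the constant [k0]. *)
Lemma chart_mx_tens (u : forall i, 'M[C]_(n, d i)) c t J i :
  t = c *: tens (fun i => wedge (u i)) -> t J <> 0 ->
  rowsub (val (J i)) (u i) \in unitmx /\
  chart_mx t J i = (t J : C) *: (u i *m invmx (rowsub (val (J i)) (u i))).
Proof.
move=> te tJ.
pose k0 := c * \prod_(j | j != i) (wedge (u j) (J j) : C).
have slice (K : index_set n (d i)) :
    t (replace_index J K) = k0 * (wedge (u i) K : C).
  rewrite te ffunE [LHS]/GRing.scale /= ffunE (bigD1 i) //= replace_index_in.
  rewrite mulrCA mulrC /k0; congr (_ * _ * _).
  by apply: eq_bigr => j ji; rewrite replace_index_out // eq_sym.
have tJE : t J = k0 * \det (rowsub (val (J i)) (u i)) :> C.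
  rewrite te ffunE [LHS]/GRing.scale /= ffunE (bigD1 i) //= ffunE.
  by rewrite mulrCA mulrC.
have uU : rowsub (val (J i)) (u i) \in unitmx.
  rewrite unitmxE unitfE; apply/eqP => u0; apply: tJ.
  by rewrite tJE u0 mulr0.
split=> //; apply/matrixP => a k; rewrite mxE.
have -> : [ffun K : index_set n (d i) => t (replace_index J K)] = k0 *: wedge (u i).
  by apply/ffunP => K; rewrite !ffunE slice ffunE.
have -> f : alt_coord (k0 *: wedge (u i)) f = k0 * alt_coord (wedge (u i)) f.
  rewrite /alt_coord big_distrr /=; apply: eq_bigr => K _.
  by rewrite ffunE mulrA.
rewrite alt_coord_wedge.
rewrite /invmx uU -scalemxAr scalerA tJE mulfK; last by rewrite -unitfE -unitmxE.
rewrite mxE; congr (_ * _); rewrite (expand_det_row _ k) mxE.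
apply: eq_bigr => b _; rewrite !mxE eqxx; congr (_ * _).
rewrite /cofactor; congr (_ * \det _); apply/matrixP => x z; rewrite !mxE.
by rewrite eq_sym (negbTE (neq_lift _ _)).
Qed.

End Chart.

(** * From the closure to flags *)

Section HomogeneousFunctions.
Variables (C : fieldType) (A : vectType C).
Implicit Types f g : A -> C.

Definition homog_fun (k : nat) f : Prop :=
  exists2 p : {mpoly C[\dim {:A}]}, p \is k.-homog &
    forall u, f u = p.@[fun i => coord (vbasis {:A}) i u].

Lemma homog_fun_ext k f g : f =1 g -> homog_fun k f -> homog_fun k g.
Proof. by move=> e [p hp pf]; exists p => // u; rewrite -e. Qed.

Lemma homog_fun_linear f : (forall c u v, f (c *: u + v) = c * f u + f v) ->
  homog_fun 1 f.
Proof.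
move=> fl; have f0 : f 0 = 0.
  have := fl (-1) 0 0; rewrite scaler0 addr0 mulN1r => ->; exact: addNr.
pose b := vbasis {:A}.
exists (\sum_(i < \dim {:A}) f b`_i *: 'X_i).
  by apply: rpred_sum => i _; apply: dhomogZ; rewrite dhomogX /= mdeg1.
move=> u; rewrite raddf_sum /= {1}(coord_vbasis (memvf u)).
under [RHS]eq_bigr => i _ do rewrite mevalZ mevalXU.
elim/big_ind2: _ => //; last by move=> i _; rewrite -[X in f X]addr0 fl f0 addr0 mulrC.
by move=> x1 x2 y1 y2 <- <-; rewrite -[x1]scale1r fl mul1r scale1r.
Qed.

Lemma homog_funM k l f g : homog_fun k f -> homog_fun l g ->
  homog_fun (k + l) (fun u => f u * g u).
Proof.
move=> [p hp pf] [q hq qg]; exists (p * q); first exact: dhomogM.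
by move=> u; rewrite mevalM pf qg.
Qed.

Lemma homog_funZ k c f : homog_fun k f -> homog_fun k (fun u => c * f u).
Proof.
move=> [p hp pf]; exists (c *: p); first exact: dhomogZ.
by move=> u; rewrite mevalZ pf.
Qed.

Lemma homog_fun0 k : homog_fun k (fun=> 0).
Proof. by exists 0; [exact: rpred0 | move=> u; rewrite meval0]. Qed.

Lemma homog_fun1 : homog_fun 0 (fun=> 1).
Proof. by exists 1; [exact: dhomog1 | move=> u; rewrite meval1]. Qed.

Lemma homog_fun_sum k (I : finType) (F : I -> A -> C) :
  (forall i, homog_fun k (F i)) -> homog_fun k (fun u => \sum_i F i u).
Proof.
move=> hF; have /fin_all_exists2[p hp pF] i : exists2 p : {mpoly C[\dim {:A}]},
  p \is k.-homog & forall u, F i u = p.@[fun i => coord (vbasis {:A}) i u].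
  exact: hF.
exists (\sum_i p i); first by apply: rpred_sum => i _.
by move=> u; rewrite raddf_sum; apply: eq_bigr => i _; apply: pF.
Qed.

Lemma homog_funD k f g : homog_fun k f -> homog_fun k g ->
  homog_fun k (fun u => f u + g u).
Proof.
move=> [p hp pf] [q hq qg]; exists (p + q); first exact: rpredD.
by move=> u; rewrite mevalD pf qg.
Qed.

Lemma homog_funB k f g : homog_fun k f -> homog_fun k g ->
  homog_fun k (fun u => f u - g u).
Proof.
move=> hf hg; apply: homog_funD => //.
by apply: homog_fun_ext (homog_funZ (-1) hg) => u; rewrite mulN1r.
Qed.

Lemma homog_fun_prod (I : finType) (k : I -> nat) (F : I -> A -> C) :
  (forall i, homog_fun (k i) (F i)) ->
  homog_fun (\sum_i k i) (fun u => \prod_i F i u).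
Proof.
move=> hF.
suff H (r : seq I) : homog_fun (\sum_(i <- r) k i) (fun u => \prod_(i <- r) F i u).
  exact: H.
elim: r => [|i r IH].
  rewrite big_nil; apply: homog_fun_ext homog_fun1 => u.
  by rewrite big_nil.
rewrite big_cons; apply: homog_fun_ext (homog_funM (hF i) IH) => u.
by rewrite big_cons.
Qed.

Lemma homog_funX k f : homog_fun 1 f -> homog_fun k (fun u => f u ^+ k).
Proof.
move=> hf; have := @homog_fun_prod 'I_k (fun=> 1%N) (fun=> f) (fun=> hf).
rewrite sum_nat_const card_ord muln1; apply: homog_fun_ext => u.
by rewrite prodr_const card_ord.
Qed.

Lemma homog_fun_det k (M : A -> 'M[C]_k) :
  (forall i j, homog_fun 1 (fun u => M u i j)) ->
  homog_fun k (fun u => \det (M u)).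
Proof.
move=> hM; apply: homog_fun_sum => s; apply: homog_funZ.
have := @homog_fun_prod 'I_k (fun=> 1%N) (fun i u => M u i (s i)) (fun i => hM i (s i)).
by rewrite sum_nat_const card_ord muln1.
Qed.

(** The product [tau * f] is homogeneous and vanishes on all of [S], also where [tau] does; hence it
    vanishes at [w]. Equations may thus be checked in one chart. *)
Lemma proj_closure_vanish (S : A -> Prop) w k (tau f : A -> C) :
  homog_fun 1 tau -> homog_fun k f ->
  (forall u, S u -> tau u <> 0 -> f u = 0) ->
  proj_closure S w -> tau w <> 0 -> f w = 0.
Proof.
move=> ht hf Sf [_ Sw] tw; have [p hp pf] := homog_funM ht hf.
have := Sw _ p hp; rewrite -pf => H.
have /eqP : tau w * f w = 0.
  apply: H => u Su; rewrite -pf; have [->|/eqP tu] := eqVneq (tau u) 0.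
    by rewrite mul0r.
  by rewrite Sf // mulr0.
by rewrite mulf_eq0 => /orP[/eqP|/eqP].
Qed.

End HomogeneousFunctions.

Section GraphProjection.
Variables (C : numFieldType) (n : nat).

(** Column [k] is [v_k] plus entries of [y] in the rows from [e] on; deleting those before row [f]
    leaves column [k] of the graph matrix for [f]. So [c] is a unit vector. *)
Lemma pr_graph_mx e f (y : 'M[C]_n) (k : 'I_e) : (e <= f)%N ->
  exists c : 'cV_f, pr e f (col k (graph_mx e y)) = graph_mx f y *m c.
Proof.
move=> ef; exists (\col_b (b == k :> nat)%:R).
have hwc : hw_mx C n f *m (\col_b (b == k :> nat)%:R) = col k (hw_mx C n e).
  apply/colP => a; rewrite !mxE.
  rewrite (bigD1 (widen_ord ef k)) //= !mxE eqxx mulr1 big1 ?addr0 // => b bk.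
  by have /negbTE bk' : (b != k :> nat) := bk; rewrite !mxE bk' mulr0.
rewrite mulmxDl -mulmxA hwc; apply/colP => a.
rewrite ![in LHS]mxE ![in RHS]mxE.
have ke : (k < e)%N := ltn_ord k.
have -> : \sum_j low_block f y a j * col k (hw_mx C n e) j 0 =
    (if (f <= a)%N then \sum_j y a j * (j == k :> nat)%:R else 0).
  case: ifP => fa; last first.
    by apply: big1 => j _; rewrite mxE fa mul0r.
  apply: eq_bigr => j _; rewrite !mxE fa /=.
  case: eqP => [jk|]; last by rewrite !mulr0.
  by rewrite jk (leq_trans ke ef).
have -> : \sum_j low_block e y a j * hw_mx C n e j k =
    (if (e <= a)%N then \sum_j y a j * (j == k :> nat)%:R else 0).
  case: ifP => fa; last first.
    by apply: big1 => j _; rewrite mxE fa mul0r.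
  apply: eq_bigr => j _; rewrite !mxE fa /=.
  case: eqP => [jk|]; last by rewrite !mulr0.
  by rewrite jk ke.
case: (ltnP a e) => ae /=.
  by rewrite [(f <= a)%N]leqNgt (leq_trans ae ef).
case: (leqP f a) => fa //=.
rewrite addr0; case: eqP => // ak.
by move: ae; rewrite ak leqNgt ke.
Qed.

End GraphProjection.

Section ClosureToFlags.
Variables (C : numFieldType) (n s : nat) (d : 'I_s -> nat).
Hypothesis d_le : forall i j : 'I_s, (i < j)%N -> (d i < d j)%N.
Variables (A : vectType C) (act : 'M[C]_n -> 'End(A)) (va : A).
Variable phi : 'Hom(A, ext_tensor C n d).
Hypothesis phiP : is_degenerate_embedding act va phi.
Variables (w : A) (J0 : tensor_index n d).
Hypothesis wP : degenerate_flag_variety act va w.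
Hypothesis wJ0 : phi w J0 <> 0.

Let tau (u : A) : C := phi u J0.
Let M (u : A) i := chart_mx (phi u) J0 i.

Lemma homog_fun_phi J : homog_fun 1 (fun u : A => phi u J : C).
Proof. by apply: homog_fun_linear => c u v; rewrite linearP !ffunE. Qed.

Lemma homog_fun_chart i a k : homog_fun 1 (fun u => M u i a k).
Proof.
apply: (@homog_fun_ext _ _ _ (fun u => \sum_(K : index_set n (d i))
   \det (rowsub (fun b => if b == k then a else val (J0 i) b)
       (\matrix_(x, b) (x == val K b)%:R)) * (phi u (replace_index J0 K) : C))).
  by move=> u; rewrite mxE; apply: eq_bigr => K _; rewrite ffunE mulrC.
apply: homog_fun_sum => K; apply: homog_funZ; exact: homog_fun_phi.
Qed.

Lemma chart_vanish k (f : A -> C) : homog_fun k f ->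
  (forall u y, phi u = tens (fun i => wedge (graph_mx (d i) y)) ->
     tau u <> 0 -> f u = 0) -> f w = 0.
Proof.
move=> hf H; apply: (proj_closure_vanish (homog_fun_phi J0) hf _ wP wJ0).
move=> u [y yn ->]; apply: H; exact: (embedding_nil_exp phiP yn).
Qed.

Lemma chart_orbit u y i : phi u = tens (fun i => wedge (graph_mx (d i) y)) ->
  tau u <> 0 ->
  rowsub (val (J0 i)) (graph_mx (d i) y) \in unitmx /\
  M u i = tau u *: (graph_mx (d i) y *m invmx (rowsub (val (J0 i)) (graph_mx (d i) y))).
Proof.
move=> uy; apply: (@chart_mx_tens _ _ _ _ (fun i => graph_mx (d i) y) 1).
by rewrite scale1r.
Qed.

Lemma chart_rowsub i : rowsub (val (J0 i)) (M w i) = (tau w)%:M.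
Proof.
apply/matrixP => b k; rewrite [LHS]mxE [RHS]mxE; apply/eqP; rewrite -subr_eq0; apply/eqP.
apply: (@chart_vanish 1 (fun u => M u i (val (J0 i) b) k - tau u *+ (b == k))).
  apply: homog_funB; first exact: homog_fun_chart.
  apply: homog_fun_ext (homog_funZ (b == k)%:R (homog_fun_phi J0)) => u.
  by rewrite mulr_natl.
move=> u y uy tu; have [gu ->] := chart_orbit i uy tu.
set g := graph_mx _ _ in gu *.
have /matrixP/(_ b k) : rowsub (val (J0 i)) (g *m invmx (rowsub (val (J0 i)) g)) = 1%:M.
  by rewrite -mul_rowsub_mx mulmxV.
rewrite [LHS]mxE [RHS]mxE => e.
by rewrite [X in X - _]mxE e mulr_natr subrr.
Qed.

(** On the orbit, [wedge (M u i) (J i)] is [tau u ^+ d i] times a ratio of two Pluecker coordinates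
    of the [i]-th graph, and [tau u] is the product of the denominators. Clearing them leaves a
    homogeneous equation. *)
Lemma chart_segre (J : tensor_index n d) :
  tau w * \prod_i (wedge (M w i) (J i) : C) =
  tau w ^+ (\sum_i d i) * (phi w J : C).
Proof.
apply/eqP; rewrite -subr_eq0; apply/eqP.
apply: (@chart_vanish (1 + \sum_i d i)%N (fun u =>
   tau u * \prod_i (wedge (M u i) (J i) : C) - tau u ^+ (\sum_i d i) * (phi u J : C))).
  apply: homog_funB.
    apply: homog_funM; first exact: homog_fun_phi.
    apply: homog_fun_prod => i.
    apply: (@homog_fun_ext _ _ _ (fun u => \det (rowsub (val (J i)) (M u i)))).
      by move=> u; rewrite ffunE.
    apply: homog_fun_det => a k.
    by apply: homog_fun_ext (homog_fun_chart (val (J i) a) k) => u; rewrite [RHS]mxE.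
  rewrite addnC; apply: homog_funM; last exact: homog_fun_phi.
  apply: homog_funX; exact: homog_fun_phi.
move=> u y uy tu.
have guJ i := (chart_orbit i uy tu).1.
have tE : tau u = \prod_i \det (rowsub (val (J0 i)) (graph_mx (d i) y)).
  by rewrite /tau uy ffunE; apply: eq_bigr => i _; rewrite ffunE.
have -> : \prod_i (wedge (M u i) (J i) : C) =
    \prod_i (tau u ^+ d i * (\det (rowsub (val (J i)) (graph_mx (d i) y)) *
      (\det (rowsub (val (J0 i)) (graph_mx (d i) y)))^-1)).
  apply: eq_bigr => i _; rewrite ffunE (chart_orbit i uy tu).2.
  rewrite -det_inv -det_mulmx -detZ mul_rowsub_mx; congr (\det _).
  by apply/matrixP => a b; rewrite !mxE.
rewrite !big_split /= -expr_sum prodfV -tE mulrCA mulrA.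
have -> : phi u J = \prod_i \det (rowsub (val (J i)) (graph_mx (d i) y)) :> C.
  by rewrite uy ffunE; apply: eq_bigr => i _; rewrite ffunE. 
have tU : tau u != 0 by apply/eqP.
move: (tau u) (\sum_(i < s) d i)%N tU => t m tU.
set p := \prod_i _.
by rewrite mulrCA mulfV // mulr1 mulrC subrr.
Qed.

(** The [J0] rows of [M w m] form [tau w] times the identity, so the [J0] rows of a vector in its
    column span are [tau w] times the coefficients. Membership in the span thus becomes a quadratic
    equation free of unknown coefficients. *)
Lemma chart_pr (l m : 'I_s) (k : 'I_(d l)) : (l < m)%N ->
  M w m *m rowsub (val (J0 m)) (pr (d l) (d m) (col k (M w l))) =
  tau w *: pr (d l) (d m) (col k (M w l)).
Proof.
move=> lm; apply/colP => a; apply/eqP; rewrite -subr_eq0; apply/eqP.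
pose x u := pr (d l) (d m) (col k (M u l)).
apply: (@chart_vanish 2 (fun u =>
   (M u m *m rowsub (val (J0 m)) (x u)) a 0 - (tau u *: x u) a 0)).
  have hx b : homog_fun 1 (fun u => x u b 0).
    case E : ((b < d l) || (d m <= b))%N.
      apply: homog_fun_ext (homog_fun_chart b k) => u.
      by rewrite /x [RHS]mxE E [RHS]mxE.
    by apply: homog_fun_ext (homog_fun0 _ 1) => u; rewrite /x [RHS]mxE E.
  apply: homog_funB.
    apply: (@homog_fun_ext _ _ _ (fun u => \sum_b M u m a b * x u (val (J0 m) b) 0)).
      by move=> u; rewrite [RHS]mxE; apply: eq_bigr => b _; congr (_ * _); rewrite [RHS]mxE.
    apply: homog_fun_sum => b; apply: (@homog_funM _ _ 1 1) => //.
    exact: homog_fun_chart.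
  apply: (@homog_fun_ext _ _ _ (fun u => tau u * x u a 0)).
    by move=> u; rewrite [RHS]mxE.
  by apply: (@homog_funM _ _ 1 1) => //; exact: homog_fun_phi.
move=> u y uy tu.
have [gl Ml] := chart_orbit l uy tu; have [gm Mm] := chart_orbit m uy tu.
suff [c xc] : exists c : 'cV_(d m), x u = graph_mx (d m) y *m c.
  rewrite xc Mm -mul_rowsub_mx -scalemxAl -mulmxA mulKmx //.
  by rewrite subrr.
have /fin_all_exists[g gP] b := pr_graph_mx y b (ltnW (d_le lm)).
set h := invmx _ in Ml.
exists (tau u *: \sum_b h b k *: g b).
rewrite -scalemxAr mulmx_sumr; under eq_bigr => b _ do rewrite -scalemxAr -gP.
apply/colP => i; rewrite /x Ml [RHS]mxE summxE.
under [X in _ = _ * X]eq_bigr => b _ do rewrite 2!mxE.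
rewrite mxE; case: ifP => _; last by rewrite big1 ?mulr0 // => b _; rewrite mulr0.
rewrite !mxE; congr (_ * _); apply: eq_bigr => b _.
by rewrite [in RHS]mxE mulrC.
Qed.

(** [V i] is the column span of [M w i]: the [J0] rows make the columns independent, and
    [chart_segre] identifies [phi w] with a multiple of the tensor product of their wedges. *)
Lemma closure_decomposable : exists V : forall i, Gr C n (d i), maps_to phi w V.
Proof.
have tU : tau w != 0 by apply/eqP.
have Minj i (c : 'cV_(d i)) : M w i *m c = 0 -> c = 0.
  move=> Mc; have : rowsub (val (J0 i)) (M w i) *m c = 0.
    by rewrite mul_rowsub_mx Mc; apply/matrixP => a b; rewrite !mxE.
  by rewrite chart_rowsub mul_scalar_mx => /eqP; rewrite scaler_eq0 (negbTE tU) => /eqP.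
pose F i : 'Hom('cV[C]_(d i), 'cV[C]_n) := linfun (mulmx (M w i)).
have dimF i : \dim (limg (F i)) == d i.
  rewrite limg_dim_eq ?dimvf /dim /= ?muln1 //.
  apply/eqP; rewrite -subv0; apply/subvP => c; rewrite memv_cap memv_ker lfunE /=.
  by case/andP=> _ /eqP/Minj ->; rewrite mem0v.
exists (fun i => exist (fun U : {vspace _} => \dim U == d i) (limg (F i)) (dimF i)).
have wc i : exists2 c : C, c <> 0 & wedge (M w i) = c *: wedge (basis_mx (d i) (limg (F i))).
  apply: wedge_basis; first exact/eqP.
    move=> k; rewrite colE; have := memv_img (F i) (memvf (delta_mx k 0)).
    by rewrite lfunE.
  apply: wedge_neq0; exact: Minj.
have /fin_all_exists2[c c0 cE] := wc.
exists (tau w * (tau w ^+ (\sum_i d i))^-1 * \prod_i c i).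
  apply/eqP; rewrite !mulf_neq0 ?invr_eq0 ?expf_neq0 //.
  by apply/prodf_neq0 => i _; apply/eqP.
apply/ffunP => J; rewrite ffunE ffunE.
have tX : tau w ^+ (\sum_i d i) != 0 by rewrite expf_neq0.
apply: (mulfI tX); rewrite -chart_segre.
have scaleE (a b e p : C) : b != 0 -> b * ((a * b^-1 * e) * p) = a * (e * p).
  by move=> b0; rewrite -mulrA -mulrA mulrCA [b * _]mulrA mulfV // mul1r.
rewrite [RHS](scaleE _ _ _ _ tX); congr (_ * _).
rewrite -big_split /=; apply: eq_bigr => i _.
by rewrite cE ffunE.
Qed.

Lemma closure_pr (V : forall i, Gr C n (d i)) (l m : 'I_s) u : maps_to phi w V ->
  (l < m)%N -> u \in val (V l) -> pr (d l) (d m) u \in val (V m).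
Proof.
move=> [c _ wV] lm ul; have dimV i : \dim (val (V i)) = d i := eqP (valP (V i)).
have MV i : let g := basis_mx (d i) (val (V i)) in rowsub (val (J0 i)) g \in unitmx /\
    M w i = tau w *: (g *m invmx (rowsub (val (J0 i)) g)).
  exact: (@chart_mx_tens _ _ _ _ (fun i => basis_mx (d i) (val (V i))) c _ J0 i wV wJ0).
have spanM i x : x \in val (V i) -> exists c : 'cV_(d i), x = M w i *m c.
  case/(basis_mx_span (dimV i)) => e ->; have [gU ->] := MV i.
  set g := basis_mx _ _ in gU *.
  exists ((tau w)^-1 *: (rowsub (val (J0 i)) g *m e)).
  rewrite -scalemxAr -scalemxAl scalerA mulVf ?scale1r; last exact/eqP.
  by rewrite mulmxA mulmxKV.
have memM i (x : 'cV_(d i)) : M w i *m x \in val (V i).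
  have [_ ->] := MV i; rewrite -scalemxAl -mulmxA; apply: rpredZ.
  exact: (basis_mx_mem (dimV i)).
have [x ->] := spanM _ _ ul.
have -> : pr (d l) (d m) (M w l *m x) = \sum_k x k 0 *: pr (d l) (d m) (col k (M w l)).
  apply/colP => a; rewrite summxE mxE.
  case: ifP => E.
    by rewrite mxE; apply: eq_bigr => k _; rewrite !mxE E mulrC.
  by rewrite big1 // => k _; rewrite !mxE E mulr0.
apply: rpred_sum => k _; apply: rpredZ.
rewrite -[pr _ _ _]scale1r -(mulVf (_ : tau w != 0)); last exact/eqP.
by rewrite -scalerA -chart_pr // rpredZ.
Qed.

End ClosureToFlags.

(** * Limits of polynomial curves *)

Section PolynomialFunctions.
Variable C : numFieldType.
Implicit Types f g : C -> C.

Definition poly_fun f : Prop := exists q : {poly C}, forall z, f z = q.[z].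

Lemma poly_fun_ext f g : f =1 g -> poly_fun f -> poly_fun g.
Proof. by move=> e [q fq]; exists q => z; rewrite -e. Qed.

Lemma poly_fun_const c : poly_fun (fun=> c).
Proof. by exists c%:P => z; rewrite hornerC. Qed.

Lemma poly_fun_id : poly_fun id.
Proof. by exists 'X => z; rewrite hornerX. Qed.

Lemma poly_funD f g : poly_fun f -> poly_fun g -> poly_fun (fun z => f z + g z).
Proof. by move=> [p fp] [q gq]; exists (p + q) => z; rewrite hornerD fp gq. Qed.

Lemma poly_funM f g : poly_fun f -> poly_fun g -> poly_fun (fun z => f z * g z).
Proof. by move=> [p fp] [q gq]; exists (p * q) => z; rewrite hornerM fp gq. Qed.

Lemma poly_fun_sum I (r : seq I) (F : I -> C -> C) :
  (forall i, poly_fun (F i)) -> poly_fun (fun z => \sum_(i <- r) F i z).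
Proof.
move=> hF; elim: r => [|i r IH].
  by apply: poly_fun_ext (poly_fun_const 0) => z; rewrite big_nil.
by apply: poly_fun_ext (poly_funD (hF i) IH) => z; rewrite big_cons.
Qed.

Lemma poly_fun_prod I (r : seq I) (F : I -> C -> C) :
  (forall i, poly_fun (F i)) -> poly_fun (fun z => \prod_(i <- r) F i z).
Proof.
move=> hF; elim: r => [|i r IH].
  by apply: poly_fun_ext (poly_fun_const 1) => z; rewrite big_nil.
by apply: poly_fun_ext (poly_funM (hF i) IH) => z; rewrite big_cons.
Qed.

Lemma poly_funX f k : poly_fun f -> poly_fun (fun z => f z ^+ k).
Proof.
move=> hf; have := poly_fun_prod (index_enum 'I_k) (fun=> hf).
by apply: poly_fun_ext => z; rewrite prodr_const card_ord.
Qed.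

Lemma poly_fun_det k (M : C -> 'M[C]_k) :
  (forall i j, poly_fun (fun z => M z i j)) -> poly_fun (fun z => \det (M z)).
Proof.
move=> hM; apply: poly_fun_sum => s; apply: poly_funM; first exact: poly_fun_const.
by apply: poly_fun_prod.
Qed.

Lemma poly_fun_meval k (p : {mpoly C[k]}) (v : 'I_k -> C -> C) :
  (forall i, poly_fun (v i)) -> poly_fun (fun z => p.@[fun i => v i z]).
Proof.
move=> hv; apply: poly_fun_ext (fun z => esym (mevalE _ _)) _.
apply: poly_fun_sum => m; apply: poly_funM; first exact: poly_fun_const.
by apply: poly_fun_prod => i; apply: poly_funX.
Qed.

Lemma poly_fun_linear (I : finType) (f : {ffun I -> C^o} -> C)
    (g : C -> {ffun I -> C^o}) :
  (forall c u v, f (c *: u + v) = c * f u + f v) ->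
  (forall i, poly_fun (fun z => g z i)) -> poly_fun (fun z => f (g z)).
Proof.
move=> fl hg; pose e i : {ffun I -> C^o} := [ffun j => (j == i)%:R].
have f0 : f 0 = 0.
  have := fl (-1) 0 0; rewrite scaler0 addr0 mulN1r => ->; exact: addNr.
apply: (@poly_fun_ext (fun z => \sum_i (g z i : C) * f (e i))).
  move=> z; have {2}-> : g z = \sum_i (g z i : C) *: e i.
    apply/ffunP => j; rewrite sum_ffunE (bigD1 j) //= !ffunE eqxx.
    rewrite -[X in X + _]/(_ * _) mulr1 big1 ?addr0 // => i ij.
    by rewrite !ffunE eq_sym (negbTE ij) scaler0.
  elim: (index_enum I) => [|i r IH]; first by rewrite !big_nil f0.
  by rewrite !big_cons fl IH.
by apply: poly_fun_sum => i; apply: poly_funM => //; apply: poly_fun_const.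
Qed.

Lemma poly_fun_eq0 f : poly_fun f -> (forall z, z <> 0 -> f z = 0) -> f 0 = 0.
Proof.
move=> [q fq] f0; suff q0 : q = 0 by rewrite fq q0 horner0.
(* The integers from 1 to [size q] are distinct nonzero roots, too many for a nonzero polynomial. *)
apply: (@roots_geq_poly_eq0 _ q [seq k.+1%:R | k <- iota 0 (size q)]).
- apply/allP => _ /mapP[k _ ->]; apply/rootP; rewrite -fq; apply: f0.
  by apply/eqP; rewrite pnatr_eq0.
- rewrite map_inj_uniq ?iota_uniq // => i j /eqP.
  by rewrite eqr_nat => /eqP[].
- by rewrite size_map size_iota.
Qed.

End PolynomialFunctions.

(** * Limits of points of the degenerate flag variety *)

Section Limits.
Variables (C : numFieldType) (n s : nat) (d : 'I_s -> nat).
Variables (A : vectType C) (act : 'M[C]_n -> 'End(A)) (va : A).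
Variable phi : 'Hom(A, ext_tensor C n d).
Hypothesis phiP : is_degenerate_embedding act va phi.

Definition in_variety (t : ext_tensor C n d) : Prop :=
  exists2 w, degenerate_flag_variety act va w & phi w = t.

Lemma in_varietyZ c t : c <> 0 -> in_variety t -> in_variety (c *: t).
Proof.
move=> c0 [w [w0 wp] <-]; exists (c *: w); last by rewrite linearZ.
split=> [/eqP|k p hp /(wp _ _ hp) e].
  by rewrite scaler_eq0 => /orP[/eqP|/eqP].
suff -> : p.@[fun i => coord (vbasis {:A}) i (c *: w)] =
    c ^+ k * p.@[fun i => coord (vbasis {:A}) i w] by rewrite e mulr0.
rewrite !mevalE big_distrr /= [LHS]big_seq [RHS]big_seq; apply: eq_bigr => m mp.
rewrite mulrCA; congr (_ * _).
have <- : mdeg m = k by exact: (dhomog_mf hp).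
rewrite mdegE expr_sum -big_split /=; apply: eq_bigr => i _.
by rewrite linearZ /= exprMn.
Qed.

(** The left inverse of [phi] carries the curve to a polynomial curve in [A]. A homogeneous equation
    of the orbit, evaluated along it, is a polynomial in [z] that vanishes for [z <> 0] and hence at
    0. *)
Lemma in_variety_limit (g : C -> ext_tensor C n d) :
  (forall J, poly_fun (fun z => g z J : C)) -> g 0 <> 0 ->
  (forall z, z <> 0 -> in_variety (g z)) -> in_variety (g 0).
Proof.
move=> hg g0 gv; pose h z : A := (phi^-1)%VF (g z).
have hw z w : phi w = g z -> h z = w.
  by move=> e; rewrite /h -e lker0_lfunK //; apply/eqP; case: phiP.
(* The image of [phi] is a linear subspace, so it contains the limit as well. *)
have ph0 : phi (h 0) = g 0.
  apply/ffunP => J; apply/eqP; rewrite -subr_eq0; apply/eqP.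
  apply: (@poly_fun_eq0 _ (fun z => phi (h z) J - g z J : C)) => [|z z0].
    apply: poly_funD; last first.
      by apply: poly_fun_ext (poly_funM (poly_fun_const (-1)) (hg J)) => z; rewrite mulN1r.
    apply: (poly_fun_linear (f := fun t => phi ((phi^-1)%VF t) J)) => // c u v.
    by rewrite !linearP !ffunE.
  by have [w _ e] := gv z z0; rewrite (hw z w e) e subrr.
exists (h 0) => //; split=> [e|k p hp Sp].
  by apply: g0; rewrite -ph0 e linear0.
apply: (@poly_fun_eq0 _ (fun z => p.@[fun i => coord (vbasis {:A}) i (h z)])).
  apply: (@poly_fun_meval _ _ p (fun i z => coord (vbasis {:A}) i (h z))) => i.
  apply: (poly_fun_linear (f := fun t => coord (vbasis {:A}) i ((phi^-1)%VF t))) => // c u v.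
  by rewrite !linearP.
by move=> z z0; have [w [_ wp] e] := gv z z0; rewrite (hw z w e); apply: wp hp Sp.
Qed.

Lemma in_variety_orbit y : in_nminus y ->
  tens (fun i => wedge (graph_mx (d i) y)) <> 0 ->
  in_variety (tens (fun i => wedge (graph_mx (d i) y))).
Proof.
move=> yn t0; exists (nil_exp (act y) va); last exact: embedding_nil_exp.
split=> [e|k p hp]; last by apply; exists y.
by apply: t0; rewrite -(embedding_nil_exp phiP yn) e linear0.
Qed.

End Limits.

Section TensorScaling.
Variables (C : fieldType) (n s : nat) (d : 'I_s -> nat).

Lemma tensZ (c : 'I_s -> C) (p : forall i, ext C n (d i)) :
  tens (fun i => c i *: p i) = (\prod_i c i) *: tens p.
Proof.
by apply/ffunP => J; rewrite !ffunE -[RHS]big_split; apply: eq_bigr => i _; rewrite ffunE.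
Qed.

Lemma tens_neq0 (p : forall i, ext C n (d i)) :
  (forall i, exists J, p i J <> 0) -> tens p <> 0.
Proof.
move=> p0; have pick i : {J | p i J != 0}.
  by apply: sigW; have [J /eqP] := p0 i; exists J.
pose J : tensor_index n d := [ffun i => sval (pick i)].
move/ffunP/(_ J); rewrite !ffunE; apply/eqP/prodf_neq0 => i _.
by rewrite ffunE; exact: svalP (pick i).
Qed.

End TensorScaling.

(** * Coordinate projections *)

Section Projections.
Variables (C : fieldType) (n : nat).
Implicit Types (u v : 'cV[C]_n) (U : {vspace 'cV[C]_n}).

Definition pr_mx i j : 'M[C]_n :=
  \matrix_(a, b) ((a == b) && ((a < i) || (j <= a))%N)%:R.

Definition mx_lfun (M : 'M[C]_n) : 'End('cV[C]_n) := linfun (mulmx M).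

Definition prl i j := mx_lfun (pr_mx i j).

Lemma mx_lfunE M u : mx_lfun M u = M *m u.
Proof. by rewrite lfunE. Qed.

Lemma mul_pr_mx i j u : pr_mx i j *m u = pr i j u.
Proof.
apply/colP => a; rewrite !mxE (bigD1 a) //= mxE eqxx big1 ?addr0 => [|b ba].
  by case: ifP; rewrite ?mul1r ?mul0r.
by rewrite mxE eq_sym (negbTE ba) mul0r.
Qed.

Lemma prlE i j u : prl i j u = pr i j u.
Proof. by rewrite mx_lfunE mul_pr_mx. Qed.

Lemma prl_comp i j k u : (i <= j)%N -> (j <= k)%N ->
  prl j k (prl i j u) = prl i k u.
Proof.
move=> ij jk; rewrite !prlE; apply/colP => a; rewrite !mxE.
by do !case: ifP => //; lia.
Qed.

Lemma prl_id i u : prl i i u = u.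
Proof. by rewrite prlE; apply/colP => a; rewrite mxE; case: ifP => //; lia. Qed.

Lemma prl_fixP i j u :
  (forall a : 'I_n, (i <= a < j)%N -> u a 0 = 0) <-> prl i j u = u.
Proof.
rewrite prlE; split=> [u0|<- a ia].
  by apply/colP => a; rewrite mxE; case: ifP => // E; rewrite u0 //; lia.
by rewrite mxE; case: ifP => // E; lia.
Qed.

Lemma dim_prl i : (i <= n)%N -> \dim (limg (prl i n)) = i.
Proof.
move=> le_in; pose E : 'M[C]_(n, i) := \matrix_(a, k) (a == k :> nat)%:R.
pose F : 'Hom('cV[C]_i, 'cV[C]_n) := linfun (mulmx E).
have Ec (c : 'cV_i) (k : 'I_i) : (E *m c) (widen_ord le_in k) 0 = c k 0.
  rewrite mxE (bigD1 k) //= mxE eqxx mul1r big1 ?addr0 // => b bk.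
  have /negbTE kb : (k != b :> nat) by rewrite eq_sym; exact: bk.
  by rewrite mxE kb mul0r.
have -> : limg (prl i n) = limg F.
  apply/vspaceP => x; apply/memv_imgP/memv_imgP => -[u _ ->].
    exists (\col_k u (widen_ord le_in k) 0); first exact: memvf.
    rewrite prlE lfunE; apply/colP => a; rewrite [LHS]mxE.
    case: (ltnP a i) => ai /=.
      have -> : a = widen_ord le_in (Ordinal ai) by apply: ord_inj.
      by rewrite Ec mxE.
    rewrite leqNgt ltn_ord /= mxE big1 // => b _; rewrite mxE.
    case: eqP => [ab|]; last by rewrite mul0r.
    by move: ai; rewrite ab leqNgt ltn_ord.
  exists (E *m u); first exact: memvf.
  rewrite lfunE; apply/esym/prl_fixP => a /andP[ia _].
  rewrite mxE big1 // => b _; rewrite mxE.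
  case: eqP => [ab|]; last by rewrite mul0r.
  by move: ia; rewrite ab leqNgt ltn_ord.
rewrite limg_dim_eq ?dimvf /dim /= ?muln1 //.
apply/eqP; rewrite -subv0; apply/subvP => c; rewrite memv_cap memv_ker lfunE /=.
case/andP=> _ /eqP Ec0; suff -> : c = 0 by rewrite mem0v.
by apply/colP => k; rewrite -Ec Ec0 !mxE.
Qed.

(** Some coordinate of [x] minus its projection to [U] is nonzero; [r] is the corresponding row of
    the complementary projector. *)
Lemma separating_row U x : x \notin U ->
  exists2 r : 'rV[C]_n, forall u, u \in U -> r *m u = 0 & r *m x != 0.
Proof.
move=> xU; pose f : 'End('cV[C]_n) := (\1 - projv U)%VF.
have fE u : f u = u - projv U u by rewrite add_lfunE opp_lfunE id_lfunE.
have [i fi] : exists i, f x i 0 != 0.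
  apply/existsP; apply: contraR xU; rewrite negb_exists => /forallP f0.
  suff /eqP : f x = 0 by rewrite fE subr_eq0 => /eqP ->; exact: memv_proj.
  by apply/colP => i; rewrite mxE; apply/eqP; have := f0 i; rewrite negbK.
have rE u : (\row_j f (delta_mx j 0) i 0) *m u = (f u i 0)%:M.
  apply/matrixP => a b; rewrite !ord1 !mxE eqxx mulr1n.
  rewrite [in RHS](matrix_sum_delta u) linear_sum summxE; apply: eq_bigr => j _.
  by rewrite big_ord1 linearZ !mxE mulrC.
exists (\row_j f (delta_mx j 0) i 0) => [u uU|].
  by rewrite rE fE projv_id // subrr mxE raddf0.
rewrite rE; apply: contra fi => /eqP/matrixP/(_ 0 0).
by rewrite !mxE eqxx mulr1n => ->.
Qed.

End Projections.

(** * Defects of degenerate flags *)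

Section DegenerateFlags.
Variables (C : fieldType) (n s : nat) (D : nat -> nat).
Hypothesis D_mono : forall l m, (l <= m)%N -> (D l <= D m)%N.
Hypothesis D_top : forall l, (s < l)%N -> D l = n.

(** Indexing by all of [nat] gives every interval of vertices in [1 .. s] a neighbour on both sides;
    past [s] the dimension is [n] and the projections are identities. *)
Definition deg_flag (V : nat -> {vspace 'cV[C]_n}) : Prop :=
  (forall l, \dim (V l) = D l) /\
  (forall l m, (l <= m)%N -> (prl C n (D l) (D m) @: V l <= V m)%VS).

Local Notation pi l := (prl C n (D l) n).

Lemma D_le_n l : (D l <= n)%N.
Proof.
case: (leqP l s) => [ls|sl]; last by rewrite D_top.
by rewrite -(D_top (ltnSn s)); apply: D_mono; apply: leq_trans ls _.
Qed.

Section OneFlag.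
Variable V : nat -> {vspace 'cV[C]_n}.
Hypothesis VP : deg_flag V.

Definition kerV l := (V l :&: lker (pi l))%VS.
Definition defect l := \dim (kerV l).

(* With P = (limg (pi l))_l, these say that the map from P_l / pi V_l to
   P_m / pi V_m is injective, resp. that the map from kerV l to kerV m is
   surjective; both spaces have dimension defect at each vertex. *)
Definition quot_inj l m := (limg (pi l) :&: (pi m @: V m) <= pi l @: V l)%VS.
Definition ker_surj l m := (kerV m <= prl C n (D l) (D m) @: kerV l)%VS.

Lemma dim_V l : \dim (V l) = D l. Proof. by case: VP. Qed.

Lemma prl_V l m u : (l <= m)%N -> u \in V l -> prl C n (D l) (D m) u \in V m.
Proof. by move=> lm ul; case: VP => _ /(_ l m lm)/subvP; apply; exact: memv_img. Qed.

Lemma pi_prl l m u : (l <= m)%N -> pi m (prl C n (D l) (D m) u) = pi l u.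
Proof. by move=> lm; rewrite prl_comp ?D_mono ?D_le_n. Qed.

Lemma pi_V_sub l m : (l <= m)%N -> (pi l @: V l <= pi m @: V m)%VS.
Proof.
move=> lm; apply/subvP => _ /memv_imgP[u ul ->].
by rewrite -(pi_prl u lm); apply: memv_img; exact: prl_V.
Qed.

Lemma limg_pi_sub l m : (l <= m)%N -> (limg (pi l) <= limg (pi m))%VS.
Proof.
move=> lm; apply/subvP => _ /memv_imgP[u _ ->].
by rewrite -(pi_prl u lm); apply: memv_img; exact: memvf.
Qed.

Lemma defect_dim l : (defect l + \dim (pi l @: V l) = D l)%N.
Proof. by rewrite /defect limg_ker_dim dim_V. Qed.

Lemma defect_top l : (s < l)%N -> defect l = 0%N.
Proof.
move=> sl; apply/eqP; rewrite dimv_eq0 -subv0; apply/subvP => u.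
by rewrite memv_cap memv_ker D_top // prl_id => /andP[_ /eqP ->]; exact: mem0v.
Qed.

Lemma prl_kerV l m u : (l <= m)%N -> u \in kerV l -> prl C n (D l) (D m) u \in kerV m.
Proof.
move=> lm; rewrite !memv_cap !memv_ker pi_prl // => /andP[uV ->].
by rewrite prl_V.
Qed.

Lemma quot_inj_trans l m k : (l <= m)%N -> (m <= k)%N ->
  quot_inj l m -> quot_inj m k -> quot_inj l k.
Proof.
move=> lm mk qlm qmk; apply: subv_trans qlm; rewrite subv_cap capvSl /=.
apply: subv_trans qmk; apply: capvS => //; exact: limg_pi_sub.
Qed.

Lemma quot_inj_chain a b : (a <= b)%N ->
  (forall c, (a <= c < b)%N -> quot_inj c c.+1) -> quot_inj a b.
Proof.
elim: b => [|b IH] ab qc; first by move: ab; rewrite leqn0 => /eqP ->; exact: capvSr.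
case: (ltngtP a b.+1) ab => // [ab _|-> _]; last exact: capvSr.
apply: (@quot_inj_trans a b); rewrite ?leqnSn //; last by apply: qc; rewrite leqnn andbT.
by apply: IH => // c /andP[ac cb]; apply: qc; rewrite ac ltnS ltnW.
Qed.

Lemma ker_surj_trans l m k : (l <= m)%N -> (m <= k)%N ->
  ker_surj l m -> ker_surj m k -> ker_surj l k.
Proof.
move=> lm mk slm smk; apply/subvP => x /(subvP smk)/memv_imgP[u um ->].
have /memv_imgP[v vl ->] := subvP slm _ um.
by rewrite prl_comp ?D_mono //; exact: memv_img.
Qed.

Lemma ker_surj_chain a b : (a <= b)%N ->
  (forall c, (a <= c < b)%N -> ker_surj c c.+1) -> ker_surj a b.
Proof.
have refl c : ker_surj c c.
  by apply/subvP => u ul; rewrite -(prl_id (D c) u); exact: memv_img.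
elim: b => [|b IH] ab qc; first by move: ab; rewrite leqn0 => /eqP ->.
case: (ltngtP a b.+1) ab => // [ab _|-> _] //.
apply: (@ker_surj_trans a b); rewrite ?leqnSn //; last by apply: qc; rewrite leqnn andbT.
by apply: IH => // c /andP[ac cb]; apply: qc; rewrite ac ltnS ltnW.
Qed.

(** The dimension formula for the sum and the intersection of [P_l] and [pi V_m], where the
    intersection is bounded by [pi V_l]. *)
Lemma quot_inj_defect l m : (l <= m)%N -> quot_inj l m ->
  (D m + defect l <= \dim (limg (pi l) + pi m @: V m)%VS + defect m)%N.
Proof.
move=> lm /dimvS q; have := dimv_sum_cap (limg (pi l)) (pi m @: V m).
rewrite dim_prl ?D_le_n //.
by have := defect_dim l; have := defect_dim m; lia.
Qed.

Lemma sum_pi_sub l m : (l <= m)%N -> (limg (pi l) + pi m @: V m <= limg (pi m))%VS.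
Proof.
move=> lm; rewrite subv_add limg_pi_sub //=; apply: limgS; exact: subvf.
Qed.

Lemma quot_inj_le l m : (l <= m)%N -> quot_inj l m -> (defect l <= defect m)%N.
Proof.
move=> lm /(quot_inj_defect lm); have := dimvS (sum_pi_sub lm).
by rewrite dim_prl ?D_le_n //; lia.
Qed.

(** An injective map between quotients of equal dimension is onto. *)
Lemma quot_inj_surj l m : (l <= m)%N -> quot_inj l m -> defect l = defect m ->
  (limg (pi l) + pi m @: V m)%VS = limg (pi m).
Proof.
move=> lm /(quot_inj_defect lm) q e; apply/eqP.
by rewrite eqEdim sum_pi_sub // dim_prl ?D_le_n //; lia.
Qed.

Lemma ker_surj_le l m : ker_surj l m -> (defect m <= defect l)%N.
Proof.
move=> /dimvS h; apply: leq_trans h _.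
by rewrite /defect -[X in (_ <= X)%N](limg_ker_dim (prl C n (D l) (D m))) leq_addl.
Qed.

Lemma ker_surj_inj l m u : ker_surj l m -> (defect l <= defect m)%N ->
  u \in kerV l -> prl C n (D l) (D m) u = 0 -> u = 0.
Proof.
move=> /dimvS h e ul u0; have := limg_ker_dim (prl C n (D l) (D m)) (kerV l).
move=> H; have : \dim (kerV l :&: lker (prl C n (D l) (D m))) == 0%N.
  rewrite -leqn0 -(leq_add2r (\dim (prl C n (D l) (D m) @: kerV l))) H add0n.
  exact: leq_trans e h.
rewrite dimv_eq0 => /eqP k0; apply/eqP; rewrite -memv0 -k0 memv_cap ul memv_ker.
exact/eqP.
Qed.

Hypothesis D0 : D 0 = 0%N.

Lemma defect0 : defect 0 = 0%N.
Proof. by have := defect_dim 0; rewrite D0; case: (defect 0). Qed.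

(** The interval is sought where the defect takes its maximal value [M]; maximality forces an end on
    both sides. *)
Lemma exists_interval l0 : (0 < defect l0)%N ->
  exists a b, [/\ (0 < a <= b)%N && (b <= s)%N, ~~ ker_surj a.-1 a,
    ~~ quot_inj b b.+1, quot_inj a b & ker_surj a b /\ defect a = defect b].
Proof.
move=> l0P; have l0s : (l0 < s.+1)%N.
  by rewrite ltnS leqNgt; apply: contraL l0P => /defect_top ->.
pose M := (\max_(l < s.+1) defect l)%N.
have leM l : (defect l <= M)%N.
  case: (ltnP l s.+1) => ls; first exact: (leq_bigmax (Ordinal ls)).
  by rewrite defect_top.
have exM : exists l, defect l == M.
  have [|i e] := @eq_bigmax _ (fun l : 'I_s.+1 => defect l); first by rewrite card_ord.
  by exists i; rewrite /M e.
have M0 : (0 < M)%N by apply: leq_trans (leM l0).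
(* [a0] is the first vertex with defect [M]. *)
case: (ex_minnP exM) => a0 /eqP a0M a0min.
have a0pos : (0 < a0)%N by case: a0 a0M {a0min} => //; rewrite defect0 => e; rewrite -e in M0.
(* If the quotient maps were injective all the way from [a0], the defect could not decrease up to
   [s.+1], where it is zero. *)
have exb : exists l, (a0 <= l <= s)%N && ~~ quot_inj l l.+1.
  have a0s : (a0 <= s)%N.
    by rewrite leqNgt; apply/negP => /defect_top e; move: M0; rewrite -a0M e.
  suff /existsP[i H] : [exists i : 'I_s.+1, (a0 <= i <= s)%N && ~~ quot_inj i i.+1] by exists i.
  apply: contraT; rewrite negb_exists => /forallP H.
  have : quot_inj a0 s.+1.
    apply: quot_inj_chain => [|c /andP[ac cs]]; first exact: leq_trans a0s _.
    by have := H (Ordinal cs); rewrite /= ac -ltnS cs /= negbK.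
  move/(quot_inj_le (leq_trans a0s (leqnSn s))).
  by rewrite a0M defect_top // leqNgt M0.
case: (ex_minnP exb) => b /andP[/andP[a0b bs] nqb] bmin.
have qi c : (a0 <= c < b)%N -> quot_inj c c.+1.
  move=> /andP[ac cb]; apply: contraT => nq.
  by have := bmin c; rewrite ac nq (leq_trans (ltnW cb) bs) leqNgt cb => /(_ isT).
have qM c : (a0 <= c <= b)%N -> defect c = M.
  move=> /andP[ac cb]; apply/eqP; rewrite eqn_leq leM /= -a0M; apply: quot_inj_le => //.
  by apply: quot_inj_chain => // x /andP[ax xc]; apply: qi; rewrite ax (leq_trans xc cb).
(* The defect jumps at [a0], so [kerV a0] is not covered by its predecessor; [a] is the last vertex
   up to [b] where this happens. *)
have exa : exists c, (a0 <= c <= b)%N && ~~ ker_surj c.-1 c.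
  exists a0; rewrite leqnn a0b /=; apply/negP => /ker_surj_le; rewrite a0M => Mle.
  have := a0min a0.-1; rewrite eqn_leq leM Mle => /(_ isT).
  by rewrite leqNgt prednK // leqnn.
have bnd c : (a0 <= c <= b)%N && ~~ ker_surj c.-1 c -> (c <= b)%N by case/andP=> /andP[].
case: (ex_maxnP exa bnd) => a /andP[/andP[a0a ab] nsa] amax.
exists a, b; split=> //.
- by rewrite ab bs andbT (leq_trans a0pos a0a).
- by apply: quot_inj_chain => // c /andP[ac cb]; apply: qi; rewrite cb (leq_trans a0a ac).
split; last by rewrite !qM ?a0a ?ab ?a0b ?leqnn.
apply: ker_surj_chain => // c /andP[ac cb]; apply: contraT => ns.
have := amax c.+1; rewrite /= ns cb (leq_trans a0a (leq_trans ac (leqnSn c))) => /(_ isT).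
by rewrite ltnNge ac.
Qed.

End OneFlag.
End DegenerateFlags.

(** * Deforming a flag to smaller defect *)

Section Step.
Variables (C : fieldType) (n s : nat) (D : nat -> nat).
Hypothesis D0 : D 0 = 0%N.
Hypothesis D_mono : forall l m, (l <= m)%N -> (D l <= D m)%N.
Hypothesis D_top : forall l, (s < l)%N -> D l = n.
Variable V : nat -> {vspace 'cV[C]_n}.
Hypothesis VP : deg_flag D V.

(** [B l] lives on the interval and sends [u] to [y] times a functional of the projection of [u].
    The functional detects a kernel vector [x] that is new at [a], and [y] represents a quotient
    class that dies after [b]. *)
Lemma deg_flag_deformation l0 : (0 < defect D V l0)%N ->
  exists B : nat -> 'M[C]_n,
    let W z l := (mx_lfun (1%:M + z *: B l) @: V l)%VS in
    [/\ forall z, deg_flag D (W z),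
        forall z, z != 0 ->
          (\sum_(l < s.+1) defect D (W z) l < \sum_(l < s.+1) defect D V l)%N
      & forall z l u, u \in V l -> (1%:M + z *: B l) *m u = 0 -> u = 0].
Proof.
case/(exists_interval D_mono D_top VP D0) => a [b].
case=> [/andP[/andP[a0 ab] bs] nsa nqb qab [sab dab]].
have ppE l m u : (l <= m)%N -> prl C n (D m) n (prl C n (D l) (D m) u) = prl C n (D l) n u.
  exact: (pi_prl D_mono D_top).
have a1a : (a.-1 <= a)%N := leq_pred a.
have a1b : (a.-1 <= b)%N := leq_trans a1a ab.
have /subvPn[x xa xN] := nsa.
(* Pushed forward to [b], [x] is still outside the image of [V a.-1], since the kernel spaces inject
   from [a] to [b]. *)
have {}xN : prl C n (D a) (D b) x \notin (prl C n (D a.-1) (D b) @: V a.-1)%VS.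
  apply: contra xN => /memv_imgP[v va e]; apply/memv_imgP; exists v.
    move: xa; rewrite !memv_cap !memv_ker va /= => /andP[_].
    by rewrite -(ppE _ _ x ab) e ppE.
  have va' : v \in kerV D V a.-1.
    move: xa; rewrite !memv_cap !memv_ker va /= => /andP[_].
    by rewrite -(ppE _ _ x ab) e ppE.
  apply/eqP; rewrite -subr_eq0; apply/eqP.
  apply: (ker_surj_inj sab); first by rewrite dab.
    by rewrite rpredB // (prl_kerV D_mono D_top VP).
  by rewrite linearB /= e prl_comp ?D_mono // subrr.
have [r rV rx] := separating_row xN.
have /subvPn[p pq pN] := nqb.
move: pq; rewrite memv_cap => /andP[pb].
(* The class of [p] in the quotient at [b] comes from the quotient at [a]: it is represented by some
   [p1] in [P_a]. *)
rewrite -(quot_inj_surj D_mono D_top VP ab qab dab) in pb.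
have [p1 p1a [p2 p2b pE]] := memv_addP pb.
case/memv_imgP => y0 y0V py0.
have [v2 v2b p2E] := memv_imgP p2b.
(* Correcting by [v2] gives a vector of [V b.+1] above [p1]. As [p1] lies in [P_a], the coordinates
   of [y] from [D a] up to, but excluding, [D b.+1] vanish, so the projections from [a] to [b.+1]
   fix it. *)
pose y := y0 - prl C n (D b) (D b.+1) v2.
have yV : y \in V b.+1 by rewrite rpredB // (prl_V VP).
have p1y : prl C n (D b.+1) n y = p1.
  by rewrite linearB /= -py0 ppE // -p2E pE addrK.
have p1N l : (a <= l <= b)%N -> p1 \notin (prl C n (D l) n @: V l)%VS.
  case/andP=> al lb; apply: contra pN => p1l; rewrite pE rpredD //.
  by move: p1l; apply: subvP; apply: (pi_V_sub D_mono D_top VP).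
have yz (c : 'I_n) : (D a <= c < D b.+1)%N -> y c 0 = 0.
  case/andP=> ac cb; have /memv_imgP[w _ p1w] := p1a.
  have := congr1 (fun u : 'cV_n => u c 0) p1y.
  rewrite prlE mxE cb /= => ->; rewrite p1w prlE mxE ltnNge ac /=.
  by rewrite leqNgt ltn_ord.
have yfix l m : (a <= l)%N -> (m <= b.+1)%N -> prl C n (D l) (D m) y = y.
  move=> al mb; apply/prl_fixP => c /andP[lc cm]; apply: yz.
  by rewrite (leq_trans (D_mono al) lc) (leq_trans cm (D_mono mb)).
have piy l : (a <= l <= b)%N -> prl C n (D l) n y = p1.
  case/andP=> al lb; rewrite -p1y -(ppE _ _ y (leqW lb)).
  by rewrite yfix.
pose xi l (u : 'cV[C]_n) : C :=
  if (a <= l <= b)%N then (r *m prl C n (D l) (D b) u) 0 0 else 0.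
pose B l : 'M[C]_n := if (a <= l <= b)%N then y *m r *m pr_mx C n (D l) (D b) else 0.
have BE z l u : (1%:M + z *: B l) *m u = u + (z * xi l u) *: y.
  rewrite mulmxDl mul1mx -scalemxAl -scalerA /B /xi; case: ifP => _; last first.
    by rewrite mul0mx scale0r.
  rewrite -!mulmxA -mx_lfunE; congr (_ + _ *: _).
  by rewrite [X in y *m X]mx11_scalar mul_mx_scalar.
(* For [l < a] both sides are zero: the projection of [u] passes through [V a.-1], whose image [r]
   annihilates. *)
have xi_prl l m u : (l <= m)%N -> (a <= m <= b)%N -> u \in V l ->
    xi m (prl C n (D l) (D m) u) = xi l u.
  move=> lm /[dup] amb /andP[am mb] ul; rewrite /xi amb prl_comp ?D_mono //.
  case: (leqP a l) => al /=; first by rewrite (leq_trans lm mb).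
  have la : (l <= a.-1)%N by rewrite -ltnS prednK.
  rewrite -(@prl_comp _ _ _ (D a.-1)) ?D_mono //.
  by rewrite rV ?mxE //; apply: memv_img; apply: (prl_V VP).
(* A nonzero coefficient would put [p1] into [pi V_l], against [p1N]. *)
have key z l u : (a <= l <= b)%N -> u \in V l ->
    prl C n (D l) n (u + (z * xi l u) *: y) = 0 -> z * xi l u = 0.
  move=> alb ul; rewrite linearD linearZ /= piy // => /eqP.
  rewrite addr_eq0 => /eqP e; apply: contraTeq (p1N _ alb) => c0.
  rewrite negbK; have -> : p1 = prl C n (D l) n (- (z * xi l u)^-1 *: u).
    by rewrite linearZ /= e scalerN scaleNr opprK scalerA mulVf // scale1r.
  by apply: memv_img; apply: rpredZ.
have inj z l u : u \in V l -> (1%:M + z *: B l) *m u = 0 -> u = 0.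
  move=> ul; rewrite BE => e.
  suff c0 : z * xi l u = 0 by move: e; rewrite c0 scale0r addr0.
  case alb : (a <= l <= b)%N; last by rewrite /xi alb mulr0.
  by apply: key => //; rewrite e linear0.
exists B; split=> //.
- move=> z; split=> [l|l m lm].
    rewrite limg_dim_eq; first exact: (dim_V VP).
    apply/eqP; rewrite -subv0; apply/subvP => u; rewrite memv_cap memv_ker mx_lfunE.
    by case/andP=> ul /eqP/(inj _ _ _ ul) ->; exact: mem0v.
  apply/subvP => _ /memv_imgP[_ /memv_imgP[u ul ->] ->].
  rewrite (mx_lfunE (1%:M + _)) BE linearD linearZ /=.
  have um := prl_V VP lm ul.
  case amb : (a <= m <= b)%N.
    apply/memv_imgP; exists (prl C n (D l) (D m) u) => //.
    rewrite (mx_lfunE (1%:M + _)) BE xi_prl //; congr (_ + _).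
    case: (leqP a l) => al; first by rewrite yfix //; case/andP: amb => _ /leqW.
    by rewrite /xi leqNgt al mulr0 !scale0r.
  have -> : (mx_lfun (1%:M + z *: B m) @: V m)%VS = V m.
    rewrite /B amb scaler0 addr0; apply/vspaceP => v.
    apply/memv_imgP/idP => [[w wm ->]|vm]; first by rewrite mx_lfunE mul1mx.
    by exists v => //; rewrite mx_lfunE mul1mx.
  apply: rpredD => //.
  case alb : (a <= l <= b)%N; last by rewrite /xi alb mulr0 scale0r mem0v.
  (* Here [m] is past [b] and [V m] is unchanged; it contains the projection of [y] because [y] is
     in [V b.+1]. *)
  case/andP: alb => al lb; have bm : (b < m)%N.
    by rewrite ltnNge; apply/negP => mb; move: amb; rewrite mb (leq_trans al lm).
  apply: rpredZ; rewrite -(@prl_comp _ _ _ (D b.+1)) ?D_mono ?leqW //.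
  by rewrite yfix //; apply: (prl_V VP).
move=> z z0.
(* No kernel space grows, and at [a] the vector [x] is lost because [xi a x] is nonzero. *)
have sub l w : w \in kerV D (fun l => mx_lfun (1%:M + z *: B l) @: V l)%VS l ->
    w \in kerV D V l /\ xi l w = 0.
  rewrite memv_cap memv_ker => /andP[/memv_imgP[u ul ->]].
  rewrite (mx_lfunE (1%:M + _)) BE => /eqP e.
  have c0 : z * xi l u = 0.
    case alb : (a <= l <= b)%N; last by rewrite /xi alb mulr0.
    exact: key e.
  move: e; rewrite c0 scale0r addr0 => e; rewrite memv_cap ul memv_ker e eqxx; split=> //.
  by move/eqP: c0; rewrite mulf_eq0 (negbTE z0) => /eqP.
have subd l : (kerV D (fun l => mx_lfun (1%:M + z *: B l) @: V l)%VS l <= kerV D V l)%VS.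
  by apply/subvP => w /sub[].
have as1 : (a < s.+1)%N by rewrite ltnS (leq_trans ab bs).
rewrite (bigD1 (Ordinal as1)) //= [X in (_ < X)%N](bigD1 (Ordinal as1)) //=.
rewrite -addSn leq_add //; last by apply: leq_sum => l _; apply: dimvS.
rewrite ltn_neqAle (dimvS (subd a)) andbT; apply/eqP => e.
have : x \in kerV D (fun l => mx_lfun (1%:M + z *: B l) @: V l)%VS a.
  by have /eqP -> : kerV D (fun l => mx_lfun (1%:M + z *: B l) @: V l)%VS a == kerV D V a
    by rewrite eqEdim subd /= -[\dim _]/(defect D V a) -e.
case/sub => _; rewrite /xi leqnn ab /= => rx0; move/negP: rx; apply.
by apply/eqP/matrixP => i j; rewrite !ord1 rx0 mxE.
Qed.

End Step.

(** * Flags without defect are graphs *)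

Section GenericFlags.
Variables (C : numFieldType) (n s : nat) (D : nat -> nat).
Hypothesis D_mono : forall l m, (l <= m)%N -> (D l <= D m)%N.
Hypothesis D_top : forall l, (s < l)%N -> D l = n.
Variable V : nat -> {vspace 'cV[C]_n}.
Hypothesis VP : deg_flag D V.

Lemma graph_mxE e (y : 'M[C]_n) (i j : 'I_n) (k : 'I_e) : j = k :> nat ->
  graph_mx e y i k = (i == j)%:R + (if (e <= i)%N then y i j else 0).
Proof.
move=> jk; rewrite !mxE -jk; congr (_ + _).
rewrite (bigD1 j) //= big1 ?addr0 => [|x xj]; last first.
  by rewrite !mxE -jk; have /negbTE -> : (x != j :> nat) := xj; rewrite mulr0.
by rewrite !mxE jk ltn_ord eqxx andbT mulr1.
Qed.

(** Without defect the projection of [V l] to [P_l] is onto, so basis vectors of [P_l] lift to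
    [V l]. Column [j] of [y] is read off such a lift. *)
Lemma deg_flag_defect0 : (forall l, defect D V l = 0%N) ->
  exists2 y : 'M[C]_n, in_nminus y &
    forall l (k : 'I_(D l)), col k (graph_mx (D l) y) \in V l.
Proof.
move=> d0.
have /fin_all_exists2[Y Ylow YV] (j : 'I_n) : exists2 v : 'cV[C]_n,
    forall i : 'I_n, (i <= j)%N -> v i 0 = 0 &
    forall m, (j < D m)%N -> exists2 g, g \in V m &
      forall i : 'I_n, g i 0 = (i == j)%:R + (if (D m <= i)%N then v i 0 else 0).
  have exl : exists l, (j < D l)%N by exists s.+1; rewrite D_top.
  (* For the smallest possible [l], the projections of a single lift serve all [m] with
     [j < D m]. *)
  case: (ex_minnP exl) => l jl lmin.
  have : delta_mx j 0 \in (prl C n (D l) n @: V l)%VS.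
    have /eqP -> : (prl C n (D l) n @: V l == limg (prl C n (D l) n))%VS.
      rewrite eqEdim limgS ?subvf //= dim_prl ?(D_le_n D_mono D_top) //.
      by have := defect_dim VP l; rewrite d0 add0n => ->.
    suff <- : prl C n (D l) n (delta_mx j 0) = delta_mx j 0 by rewrite memv_img ?memvf.
    apply/prl_fixP => i /andP[li _]; rewrite mxE.
    by case: eqP => // ij; move: jl; rewrite -ij ltnNge li.
  case/memv_imgP => g gl /esym gE.
  exists (\col_i if (D l <= i)%N then g i 0 else 0).
    by move=> i ij; rewrite mxE leqNgt (leq_ltn_trans ij jl).
  move=> m jm; have lm := lmin m jm.
  exists (prl C n (D l) (D m) g) => [|i]; first exact: (prl_V VP).
  have := congr1 (fun u : 'cV_n => u i 0) gE; rewrite !prlE !mxE eqxx andbT.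
  have := D_mono lm; rewrite [(n <= i)%N]leqNgt ltn_ord orbF.
  case: (ltnP i (D l)) => il lDm /=.
    by move=> ->; rewrite [(D m <= i)%N]leqNgt (leq_trans il lDm) addr0.
  move=> <-; rewrite add0r; by case: leqP.
exists (\matrix_(i, j) Y j i 0).
  by move=> i j ij; rewrite mxE Ylow.
move=> l k; have kn : (k < n)%N := leq_trans (ltn_ord k) (D_le_n D_mono D_top l).
have [g gl gE] := YV (Ordinal kn) l (ltn_ord k).
suff -> : col k (graph_mx (D l) (\matrix_(i, j) Y j i 0)) = g by [].
apply/colP => i; rewrite mxE (@graph_mxE _ _ _ (Ordinal kn)) // gE.
by case: ifP => //; rewrite mxE.
Qed.

End GenericFlags.

(** * From flags to the closure *)

Section FlagsToClosure.
Variables (C : numFieldType) (n s : nat) (d : 'I_s -> nat).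
Hypothesis d_le_n : forall i, (d i <= n)%N.
Hypothesis d_lt : forall i j : 'I_s, (i < j)%N -> (d i < d j)%N.
Variables (A : vectType C) (act : 'M[C]_n -> 'End(A)) (va : A).
Variable phi : 'Hom(A, ext_tensor C n d).
Hypothesis phiP : is_degenerate_embedding act va phi.

(* The chain is extended by V_0 = 0 and V_l = C^n for l > s; the vertex i of
   'I_s becomes i.+1. *)
Definition ext_dim l : nat := if l is l'.+1 then oapp d n (insub l') else 0%N.

Definition ext_flag (V : forall i, Gr C n (d i)) l : {vspace 'cV[C]_n} :=
  if l is l'.+1 then oapp (fun i => val (V i)) fullv (insub l') else 0%VS.

Lemma ext_dim_ord (i : 'I_s) : ext_dim i.+1 = d i.
Proof. by rewrite /ext_dim valK. Qed.

Lemma ext_dim_top l : (s < l)%N -> ext_dim l = n.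
Proof. by case: l => // l; rewrite ltnS => sl; rewrite /ext_dim insubN // -leqNgt. Qed.

Lemma ext_dim_mono l m : (l <= m)%N -> (ext_dim l <= ext_dim m)%N.
Proof.
case: l m => [|l] [|m] //; rewrite ltnS /ext_dim => lm.
case: insubP => [i ls li|ls]; case: insubP => [j ms mj|ms] //=.
- case: (ltngtP l m) lm => // [lm _|e _]; first by apply: ltnW; apply: d_lt; rewrite li mj.
  by have -> : i = j by apply: ord_inj; rewrite li mj.
- by move: ls; rewrite (leq_ltn_trans lm ms).
Qed.

Lemma ext_flagP (V : forall i, Gr C n (d i)) :
  (forall l m : 'I_s, (l < m)%N ->
     forall u, u \in val (V l) -> pr (d l) (d m) u \in val (V m)) ->
  deg_flag ext_dim (ext_flag V).
Proof.
move=> HV; split=> [[|l]|l m lm].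
- by rewrite dimv0.
- rewrite /ext_flag /ext_dim; case: insubP => [i _ _|_] /=; first exact/eqP/(valP (V i)).
  by rewrite dimvf /dim /= muln1.
case: l m lm => [|l] [|m] //; rewrite ?limg0 ?sub0v //.
rewrite ltnS /ext_flag /ext_dim => lm; case: (insubP _ m) => [j ms mj|ms] /=; last exact: subvf.
case: insubP => [i ls li|]; last by rewrite (leq_ltn_trans lm ms).
apply/subvP => _ /memv_imgP[u ul ->] /=; rewrite /= in ul.
case: (ltngtP l m) lm => // [lm _|e _].
  by rewrite prlE; apply: HV; rewrite ?li ?mj.
have ij : i = j by apply: ord_inj; rewrite li mj.
by rewrite -ij prl_id.
Qed.

Definition flag_tens (V : nat -> {vspace 'cV[C]_n}) : ext_tensor C n d :=
  tens (fun i : 'I_s => wedge (basis_mx (d i) (V i.+1))).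

Lemma wedges_basis (V : nat -> {vspace 'cV[C]_n}) (u : forall i, 'M[C]_(n, d i)) :
  deg_flag ext_dim V -> (forall i k, col k (u i) \in V i.+1) ->
  (forall i (c : 'cV_(d i)), u i *m c = 0 -> c = 0) ->
  exists2 c : C, c <> 0 & tens (fun i => wedge (u i)) = c *: flag_tens V.
Proof.
move=> [dimV _] uV ui.
have /fin_all_exists2[c c0 cE] (i : 'I_s) : exists2 c : C, c <> 0 &
    wedge (u i) = c *: wedge (basis_mx (d i) (V i.+1)).
  apply: wedge_basis => //; first by rewrite dimV ext_dim_ord.
  by apply: wedge_neq0; exact: ui.
exists (\prod_i c i); first by apply/eqP/prodf_neq0 => i _; apply/eqP.
rewrite -tensZ; apply/ffunP => J; rewrite !ffunE; apply: eq_bigr => i _.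
by rewrite cE.
Qed.

Lemma flag_tens_neq0 V : deg_flag ext_dim V -> flag_tens V <> 0.
Proof.
move=> [dimV _]; apply: tens_neq0 => i; apply: wedge_basis_neq0.
by rewrite dimV ext_dim_ord.
Qed.

Lemma flag_in_variety (V : nat -> {vspace 'cV[C]_n}) :
  deg_flag ext_dim V -> in_variety act va phi (flag_tens V).
Proof.
pose total (V : nat -> {vspace 'cV[C]_n}) := (\sum_(l < s.+1) defect ext_dim V l)%N.
move: {2}(total V) (leqnn (total V)) => N.
elim: N V => [|N IH] V.
  rewrite leqn0 sum_nat_eq0 => /forallP tot0 VP.
  have d0 l : defect ext_dim V l = 0%N.
    case: (ltnP l s.+1) => ls; first exact/eqP/(tot0 (Ordinal ls)).
    exact: (defect_top ext_dim_top).
  have [y yn yV] := deg_flag_defect0 ext_dim_mono ext_dim_top VP d0.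
  have ginj (i : 'I_s) (c : 'cV_(d i)) : graph_mx (d i) y *m c = 0 -> c = 0.
    move=> gc; apply/colP => k; rewrite [RHS]mxE.
    have kn := leq_trans (ltn_ord k) (d_le_n i).
    have := congr1 (fun u : 'cV_n => u (Ordinal kn) 0) gc.
    rewrite /= [LHS]mxE [RHS]mxE (bigD1 k) //= (@graph_mxE _ _ _ _ _ (Ordinal kn)) // eqxx.
    rewrite [(d i <= _)%N]leqNgt /= ltn_ord /= addr0 mul1r big1 ?addr0 // => b bk.
    have bn := leq_trans (ltn_ord b) (d_le_n i).
    rewrite (@graph_mxE _ _ _ _ _ (Ordinal bn)) // [(d i <= _)%N]leqNgt /= ltn_ord /= addr0.
    have /negbTE -> : Ordinal kn != Ordinal bn by rewrite eq_sym; exact: bk.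
    by rewrite mul0r.
  have yV' (i : 'I_s) (k : 'I_(d i)) : col k (graph_mx (d i) y) \in V i.+1.
    by move: k; rewrite -ext_dim_ord => k.
  have [c c0 cE] := wedges_basis VP yV' ginj.
  have -> : flag_tens V = c^-1 *: tens (fun i => wedge (graph_mx (d i) y)).
    by rewrite cE scalerA mulVf ?scale1r //; apply/eqP.
  apply: in_varietyZ; first by apply/eqP; rewrite invr_eq0; apply/eqP.
  apply: in_variety_orbit => //; apply: tens_neq0 => i.
  by apply: wedge_neq0; exact: ginj.
move=> tot VP; case: (leqP (total V) N) => [/IH|totN]; first exact.
have [l0 l0P] : exists l0, (0 < defect ext_dim V l0)%N.
  have : total V != 0%N by rewrite -lt0n; apply: leq_trans totN.
  rewrite sum_nat_eq0 negb_forall => /existsP[l /= ld]; exists l.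
  by rewrite lt0n.
have [B [WP Wtot Winj]] :=
  deg_flag_deformation (erefl : ext_dim 0 = 0%N) ext_dim_mono ext_dim_top VP l0P.
(* One fixed basis of [V i.+1] is moved along, so that the coordinates are polynomial in [z];
   [wedges_basis] compares it with the chosen basis of the moved space. *)
pose u z (i : 'I_s) := (1%:M + z *: B i.+1) *m basis_mx (d i) (V i.+1).
pose g z := tens (fun i => wedge (u z i)).
have dimV (i : 'I_s) : \dim (V i.+1) = d i by case: VP => -> _; rewrite ext_dim_ord.
have g0 : g 0 = flag_tens V.
  apply/ffunP => J; rewrite !ffunE; apply: eq_bigr => i _.
  by rewrite /u scale0r addr0 mul1mx.
rewrite -g0; apply: (in_variety_limit phiP).
- move=> J.
  apply: (@poly_fun_ext _ (fun z => \prod_i \det (rowsub (val (J i)) (u z i)))).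
    by move=> z; rewrite ffunE; apply: eq_bigr => i _; rewrite ffunE.
  apply: poly_fun_prod => i; apply: poly_fun_det => a k.
  apply: (@poly_fun_ext _ (fun z => \sum_j ((1%:M : 'M[C]_n) (val (J i) a) j +
      z * B i.+1 (val (J i) a) j) * basis_mx (d i) (V i.+1) j k)).
    move=> z; rewrite 2!mxE; apply: eq_bigr => j _; congr (_ * _).
    by rewrite [RHS]mxE [X in _ = _ + X]mxE.
  apply: poly_fun_sum => j; apply: poly_funM; last exact: poly_fun_const.
  apply: poly_funD; first exact: poly_fun_const.
  apply: poly_funM; [exact: poly_fun_id | exact: poly_fun_const].
- by rewrite g0; exact: flag_tens_neq0.
move=> z z0.
have [||c c0 gE] := @wedges_basis (fun l => mx_lfun (1%:M + z *: B l) @: V l)%VS (u z) (WP z).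
- move=> i k; rewrite colE /u -mulmxA -mx_lfunE; apply: memv_img.
  exact: basis_mx_mem.
- move=> i c uc; apply: (basis_mx_inj (dimV i)).
  apply: (Winj z i.+1); last by rewrite mulmxA.
  exact: basis_mx_mem.
rewrite [g z]gE; apply: in_varietyZ => //; apply: IH; last exact: WP.
by rewrite -ltnS; apply: leq_trans tot; apply: Wtot; apply/eqP.
Qed.

Lemma flag_tens_plucker (V : forall i, Gr C n (d i)) :
  flag_tens (ext_flag V) = tens (fun i => plucker (V i)).
Proof.
apply/ffunP => J; rewrite [LHS]ffunE [RHS]ffunE; apply: eq_bigr => i _.
by rewrite /ext_flag valK.
Qed.

Lemma flags_in_closure (V : forall i, Gr C n (d i)) :
  (forall l m : 'I_s, (l < m)%N ->
     forall u, u \in val (V l) -> pr (d l) (d m) u \in val (V m)) ->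
  exists2 w, degenerate_flag_variety act va w & maps_to phi w V.
Proof.
move=> /ext_flagP/flag_in_variety[w wP wE]; exists w => //.
exists 1; first exact/eqP/oner_neq0.
by rewrite wE flag_tens_plucker scale1r.
Qed.

End FlagsToClosure.

(** * The two inclusions together *)

Unset Implicit Arguments.
Local Open Scope complex_scope.

Theorem theorem2p5 (R : realType) (n s : nat) (d : 'I_s -> nat)
  (hs : (0 < s)%N)
  (hd1 : forall i, (1 <= d i <= n - 1)%N)
  (hd : forall i j : 'I_s, (i < j)%N -> (d i < d j)%N)
  (W : vectType R[i]) (rho : 'M[R[i]]_n -> 'End(W)) (v : W)
  (hW : is_irr_hw_module rho (fun h => \sum_(i < s) fund_weight (d i) h) v)
  (A : vectType R[i]) (cl : nat -> 'Hom(W, A)) (act : 'M[R[i]]_n -> 'End(A))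
  (hA : is_pbw_degeneration rho v cl act)
  (phi : 'Hom(A, ext_tensor R[i] n d))
  (hphi : is_degenerate_embedding act (cl 0%N v) phi) :
  (forall w, degenerate_flag_variety act (cl 0%N v) w ->
     exists V : forall i, Gr R[i] n (d i), maps_to phi w V) /\
  (forall V : forall i, Gr R[i] n (d i),
     (exists2 w, degenerate_flag_variety act (cl 0%N v) w & maps_to phi w V)
     <->
     (forall l m : 'I_s, (l < m)%N ->
        forall u, u \in val (V l) -> pr (d l) (d m) u \in val (V m))).
Proof.
(* Injectivity of [phi] provides the nonvanishing coordinate that fixes the chart. *)
have nz w : degenerate_flag_variety act (cl 0%N v) w -> exists J, phi w J <> 0.
  move=> [w0 _]; have /eqP : phi w <> 0.
    by rewrite -(linear0 phi) => /(embedding_inj hphi).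
  case: (pickP (fun J => phi w J != 0)) => [J /eqP|H /eqP[]]; first by exists J.
  by apply/ffunP => J; rewrite ffunE; have /negbFE/eqP := H J.
split=> [w wP|V].
  by have [J wJ] := nz w wP; apply: (closure_decomposable hphi wP wJ).
split=> [[w wP wV] l m lm u ul|HV].
  by have [J wJ] := nz w wP; apply: (closure_pr hd hphi wP wJ wV lm ul).
have dn i : (d i <= n)%N by have /andP[_ /leq_trans] := hd1 i; apply; apply: leq_subr.
exact: (flags_in_closure dn hd hphi HV).
Qed.
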